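(* Let $M$ be a finite monoid, $p>0$ a prime, and $(F,\mathcal O,k)$ a splitting $p$-modular system for $M$. Let $D$ be the decomposition matrix. Then $C(kM)=D^TC(FM)D$ with $D$ a full rank matrix. In particular, if $FM$ is semisimple, then $C(kM)=D^TD$ is a positive definite symmetric matrix.
   Context: A (complete) $p$-modular system $(F,\mathcal O,k)$ consists of a complete discrete valuation ring $\mathcal O$ of characteristic $0$ with maximal ideal $\mathfrak m$, field of fractions $F$ and residue field $k=\mathcal O/\mathfrak m$ of characteristic $p$. It is splitting for $M$ if $F$ is a splitting field for $FM$ and $k$ is a splitting field for $kM$. For a finite dimensional algebra $A$, $G_0(A)$ is the Grothendieck group of finitely generated left $A$-modules modulo short exact sequences. The decomposition map $d\colon G_0(FM)\to G_0(kM)$ is the well-defined homomorphism with $d([V])=[k\otimes_{\mathcal O}L]$, where $L$ is any $\mathcal OM$-module, finitely generated and free over $\mathcal O$, with $F\otimes_{\mathcal O}L\cong V$. Let $P_1,\ldots,P_n$ represent the isomorphism classes of projective indecomposable $FM$-modules, with simple tops $S_i=P_i/\mathrm{rad}(P_i)$, and let $Q_1,\ldots,Q_r$ represent the isomorphism classes of projective indecomposable $kM$-modules, with simple tops $T_j=Q_j/\mathrm{rad}(Q_j)$. The decomposition matrix is the $n\times r$ matrix $D=(d_{ij})$ defined by $d([S_i])=\sum_{j=1}^r d_{ij}[T_j]$. The Cartan matrices are $C(FM)_{ij}=$ the multiplicity of $S_i$ as a composition factor of $P_j$, and $C(kM)_{ij}=$ the multiplicity of $T_i$ as a composition factor of $Q_j$.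 *)

(* Defs.v *)
From HB Require Import structures.
From mathcomp Require Import all_boot all_order all_algebra.
From mathcomp Require Import boolp classical_sets.
From mathcomp Require Import freeg.

Set Implicit Arguments.
Unset Strict Implicit.
Unset Printing Implicit Defensive.

Import GRing.Theory.
Local Open Scope ring_scope.

#[short(type="finMonoidType")]
HB.structure Definition FinMonoid := { M of Monoid M & Finite M }.

Section DVR.
Variable O : idomainType.
Implicit Types (I : O -> Prop) (x : O).

Definition is_ideal I : Prop :=
  [/\ I 0, (forall x y, I x -> I y -> I (x + y))
    & (forall a x, I x -> I (a * x))].

Fixpoint ideal_pow I (n : nat) : O -> Prop :=
  if n is n'.+1 then fun x =>
    exists2 s : seq (O * O),
      (forall ab, ab \in s -> I ab.1 /\ ideal_pow I n' ab.2)
      & x = \sum_(ab <- s) ab.1 * ab.2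
  else fun=> True.

Definition nonunits x : Prop := x \isn't a GRing.unit.

(* A local principal ideal domain that is not a field. *)
Definition is_DVR : Prop :=
  [/\ (forall I, is_ideal I ->
         exists a, forall x, I x <-> exists b, x = b * a),
      is_ideal nonunits
    & exists2 x, nonunits x & x != 0].

(* Bijectivity of O -> lim_n O/I^n. *)
Definition adic_complete I : Prop :=
  (forall x, (forall n, ideal_pow I n x) -> x = 0) /\
  (forall a : nat -> O, (forall n, ideal_pow I n (a n.+1 - a n)) ->
     exists l, forall n, ideal_pow I n (l - a n)).

End DVR.

Record p_modular_system (p : nat) (F : fieldType) (O : idomainType)
    (k : fieldType) := PModularSystem {
  pms_incl : {rmorphism O -> F};
  pms_res : {rmorphism O -> k};
  pms_dvr : is_DVR O;
  pms_complete : adic_complete (@nonunits O);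
  pms_char0 : [pchar O] =i pred0;
  pms_incl_inj : injective pms_incl;
  pms_frac : forall x : F, exists a b : O,
    b != 0 /\ x = pms_incl a / pms_incl b;
  pms_res_surj : forall y : k, exists a : O, pms_res a = y;
  pms_res_ker : forall a : O, pms_res a = 0 <-> nonunits a;
  pms_charp : p \in [pchar k]
}.

(* A left RM-module with underlying R-module R^n amounts to a monoid     *)
(* morphism M -> 'M[R]_n, matrices acting on column vectors.  Over a     *)
(* field these are, up to isomorphism, the finitely generated left       *)
(* modules; over a principal ideal domain, those that are moreover free  *)
(* over R.                                                               *)

Record lmod (R : comNzRingType) (M : finMonoidType) := LMod {
  ldim : nat;
  lact : M -> 'M[R]_ldim;
  lact1 : lact 1%g = 1%:M;
  lactM : forall x y : M, lact (x * y)%g = lact x *m lact y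
}.
Arguments lact {R M} l _.

HB.instance Definition _ R M := gen_eqMixin (lmod R M).
HB.instance Definition _ R M := gen_choiceMixin (lmod R M).

Section BaseChange.
Variables (R R' : comNzRingType) (phi : {rmorphism R -> R'}).
Variables (M : finMonoidType) (V : lmod R M).

Let bact (m : M) : 'M[R']_(ldim V) := map_mx phi (lact V m).

Fact bact1 : bact 1%g = 1%:M.
Proof. by rewrite /bact lact1 map_mx1. Qed.

Fact bactM (x y : M) : bact (x * y)%g = bact x *m bact y.
Proof. by rewrite /bact lactM map_mxM. Qed.

Definition base_change : lmod R' M := LMod bact1 bactM.

End BaseChange.

(* The monoid algebra RM as a left module over itself, in the basis M.   *)
Section Regular.
Variables (R : comNzRingType) (M : finMonoidType).

Let ract (m : M) : 'M[R]_#|M| :=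
  \matrix_(i, j) (enum_val i == (m * enum_val j)%g)%:R.

Fact ract1 : ract 1%g = 1%:M.
Proof. by apply/matrixP=> i j; rewrite !mxE mul1g (inj_eq enum_val_inj). Qed.

Fact ractM (x y : M) : ract (x * y)%g = ract x *m ract y.
Proof.
apply/matrixP=> i j; rewrite !mxE (bigD1 (enum_rank (y * enum_val j)%g)) //=.
rewrite !mxE enum_rankK eqxx mulr1 mulgA big1 ?addr0 // => l ne.
rewrite !mxE; case: (enum_val l =P _) => [eql|_]; last by rewrite mulr0.
by rewrite -eql enum_valK eqxx in ne.
Qed.

Definition regular_lmod : lmod R M := LMod ract1 ractM.

End Regular.

Section Modules.
Variables (F : fieldType) (M : finMonoidType).
Implicit Types U V W P S : lmod F M.

Local Notation vec V := 'cV[F]_(ldim V).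

Definition is_hom V W (f : 'Hom(vec V, vec W)) : Prop :=
  forall (m : M) (v : vec V), f (lact V m *m v) = lact W m *m f v.

Definition inj_hom V W (f : 'Hom(vec V, vec W)) : Prop :=
  is_hom f /\ lker f = 0%VS.

Definition surj_hom V W (f : 'Hom(vec V, vec W)) : Prop :=
  is_hom f /\ limg f = fullv.

Definition isomorphic V W : Prop :=
  exists2 f : 'Hom(vec V, vec W), inj_hom f & surj_hom f.

(* 0 -> U -> V -> W -> 0 *)
Definition short_exact U V W : Prop :=
  exists (f : 'Hom(vec U, vec V)) (g : 'Hom(vec V, vec W)),
    [/\ inj_hom f, surj_hom g & limg f = lker g].

Definition is_submod V (X : {vspace vec V}) : Prop :=
  forall (m : M) (v : vec V), v \in X -> lact V m *m v \in X.

Definition simple_lmod V : Prop :=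
  (0 < ldim V)%N /\
  forall X : {vspace vec V}, is_submod X -> X = 0%VS \/ X = fullv.

Definition semisimple_lmod V : Prop :=
  forall X : {vspace vec V}, is_submod X ->
    exists2 Y : {vspace vec V}, is_submod Y
      & (X + Y)%VS = fullv /\ (X :&: Y)%VS = 0%VS.

Definition semisimple_algebra : Prop := semisimple_lmod (regular_lmod F M).

Definition indecomposable V : Prop :=
  (0 < ldim V)%N /\
  forall X Y : {vspace vec V}, is_submod X -> is_submod Y ->
    (X + Y)%VS = fullv -> (X :&: Y)%VS = 0%VS -> X = 0%VS \/ Y = 0%VS.

Definition projective P : Prop :=
  forall V W (g : 'Hom(vec V, vec W)) (f : 'Hom(vec P, vec W)),
    surj_hom g -> is_hom f ->
    exists2 h : 'Hom(vec P, vec V), is_hom h & (g \o h)%VF = f.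

Definition maximal_submod V (X : {vspace vec V}) : Prop :=
  [/\ is_submod X, X <> fullv
    & forall Y : {vspace vec V}, is_submod Y -> (X <= Y)%VS ->
        Y = X \/ Y = fullv].

Definition in_rad V (v : vec V) : Prop :=
  forall X : {vspace vec V}, maximal_submod X -> v \in X.

(* S is isomorphic to V / rad V. *)
Definition is_top S V : Prop :=
  exists2 g : 'Hom(vec V, vec S), surj_hom g
    & forall v : vec V, v \in lker g <-> in_rad v.

Definition represents_PIMs (n : nat) (P : 'I_n -> lmod F M) : Prop :=
  [/\ forall i, projective (P i) /\ indecomposable (P i),
      forall i j, isomorphic (P i) (P j) -> i = j
    & forall V, projective V -> indecomposable V ->
        exists i, isomorphic V (P i)].

Definition splitting_field : Prop :=
  forall V, simple_lmod V -> forall f : 'End(vec V), is_hom f ->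
    exists c : F, f = c *: \1%VF.

(* [composition_factors V s]: V has a composition series with successive *)
(* factors the entries of s, from the top down.                          *)
Inductive composition_factors : lmod F M -> seq (lmod F M) -> Prop :=
| CompNil V : ldim V = 0%N -> composition_factors V [::]
| CompCons U V W s : short_exact U V W -> simple_lmod W ->
    composition_factors U s -> composition_factors V (W :: s).

(* By the Jordan-Hoelder theorem the set below is a singleton when S is  *)
(* simple.                                                               *)
Definition multiplicity S V : nat :=
  xget 0%N [set m : nat | exists2 s, composition_factors V s
                            & m = count (fun W => `[< isomorphic W S >]) s].

Definition cartan (n : nat) (P S : 'I_n -> lmod F M) : 'M[int]_n :=
  \matrix_(i, j) (multiplicity (S i) (P j))%:Z.

(* The Grothendieck group: the free abelian group on the modules, modulo *)
(* the subgroup generated by the relations of short exact sequences.     *)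
Inductive G0_relation : {freeg (lmod F M) / int} -> Prop :=
| G0_rel0 : G0_relation 0
| G0_relB x y : G0_relation x -> G0_relation y -> G0_relation (x - y)
| G0_rel_ses U V W : short_exact U V W ->
    G0_relation (<< V >> - << U >> - << W >>).

Definition G0_rel : {pred {freeg (lmod F M) / int}} :=
  fun x => `[< G0_relation x >].

Fact G0_rel_zmod : zmod_closed G0_rel.
Proof.
split=> [|x y]; rewrite -!topredE /=; first exact/asboolP/G0_rel0.
by move=> /asboolP Hx /asboolP Hy; apply/asboolP/G0_relB.
Qed.

HB.instance Definition _ := GRing.isZmodClosed.Build _ G0_rel G0_rel_zmod.

Definition G0 : Type := Quotient.quot G0_rel.
HB.instance Definition _ := GRing.Zmodule.on G0.

Definition G0_class V : G0 := (\pi_(Quotient.quot G0_rel) << V >>)%qT.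

End Modules.

(* A finitely generated O-free OM-module is an L : lmod O M; its base     *)
(* changes along O -> F and O -> k are F (x) L and k (x) L.               *)
Definition is_decomposition_map p F O k (sys : p_modular_system p F O k)
    (M : finMonoidType) (d : {additive G0 F M -> G0 k M}) : Prop :=
  forall (V : lmod F M) (L : lmod O M),
    isomorphic (base_change (pms_incl sys) L) V ->
    d (G0_class V) = G0_class (base_change (pms_res sys) L).

(* Positive definiteness over the reals, or any other ordered field. *)
Definition positive_definite (r : nat) (A : 'M[int]_r) : Prop :=
  forall (K : realFieldType) (x : 'cV[K]_r), x != 0 ->
    0 < (x^T *m map_mx intr A *m x) 0 0.

(* Main.v *)
(* Each PIM is the image of an idempotent of the monoid algebra: [Q j] of some
   [e' j] in kM and [P i] of some [e i] in FM; lift [e' j] to an idempotent [Z j]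
   of OM.  The multiplicity of a simple top in a module V is the rank of its
   idempotent acting on V, and an idempotent matrix over O has the same rank over
   F and over k.  Hence [D i j] is the rank of [Z j] on [S i], so that
   [Z j = sum_i D i j e i] modulo [FM, FM] (Hattori-Stallings).  The entry (j, l)
   of C(kM) is the trace over F of a |-> Z_j a Z_l, and that of C(FM) the trace of
   a |-> e_i a e_i'; these depend only on the idempotents modulo commutators and F
   has characteristic 0, which gives C(kM) = D^T C(FM) D.

   If D x = 0 with x integral, then [sum_j x_j Z j] is a commutator over F.  Since
   OM / [OM, OM] is free over O, on a basis that does not depend on the ring, it is
   a commutator over O and its reduction one over k; applying the character of
   [T l] gives x_l = 0 in k, so p divides x.  By descent x = 0. *)
From HB Require Import structures.
Require Import Defs.
From mathcomp Require Import all_boot all_order all_algebra.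
From mathcomp Require Import boolp classical_sets freeg ring.
Import GRing.Theory.
Local Open Scope ring_scope.

Set Implicit Arguments.
Unset Strict Implicit.
Unset Printing Implicit Defensive.

(** * The action of the monoid algebra *)

Section Action.
Variables (R : comNzRingType) (M : finMonoidType).
Implicit Types V W : lmod R M.

Definition intertwiner V W (B : 'M[R]_(ldim W, ldim V)) : Prop :=
  forall m, B *m lact V m = lact W m *m B.

Definition lreg (m : M) : 'M[R]_#|M| := lact (regular_lmod R M) m.

Definition mbasis (x : M) : 'cV[R]_#|M| := delta_mx (enum_rank x) 0.

Definition mact V (a : 'cV[R]_#|M|) : 'M[R]_(ldim V) :=
  \sum_(m : M) a (enum_rank m) 0 *: lact V m.

Definition endo (E : 'M[R]_#|M|) : Prop :=
  forall m, E *m lreg m = lreg m *m E.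

(* Elements of [endo] are the right multiplications of RM, so that [ev V E]
   is the action on V of the element E(1) of RM, and [ev V] is an
   anti-homomorphism. *)
Definition ev V (E : 'M[R]_#|M|) : 'M[R]_(ldim V) := mact V (E *m mbasis 1%g).

Lemma lreg_mul x y : lreg (x * y)%g = lreg x *m lreg y.
Proof. exact: (lactM (regular_lmod R M)). Qed.

Lemma lreg_mbasis m x : lreg m *m mbasis x = mbasis (m * x)%g.
Proof.
rewrite /mbasis -colE; apply/colP=> i; rewrite !mxE enum_rankK andbT.
by rewrite -[i == _](inj_eq (@enum_val_inj _ _)) enum_rankK.
Qed.

Lemma mbasis_decomp (a : 'cV[R]_#|M|) :
  a = \sum_(m : M) a (enum_rank m) 0 *: mbasis m.
Proof.
apply/colP=> i; rewrite summxE (bigD1 (enum_val i)) //= big1 ?addr0.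
  by rewrite !mxE enum_valK !eqxx mulr1.
move=> m ne; rewrite !mxE andbT; case: eqP => [e|_]; last by rewrite mulr0.
by case/eqP: ne; rewrite e enum_rankK.
Qed.

Lemma mactD V a b : mact V (a + b) = mact V a + mact V b.
Proof.
by rewrite /mact -big_split; apply: eq_bigr => m _; rewrite mxE scalerDl.
Qed.

Lemma mactZ V c a : mact V (c *: a) = c *: mact V a.
Proof.
by rewrite /mact scaler_sumr; apply: eq_bigr => m _; rewrite mxE scalerA.
Qed.

Lemma mact0 V : mact V 0 = 0.
Proof. by rewrite /mact big1 // => m _; rewrite mxE scale0r. Qed.

Lemma mact_sum V (I : Type) (s : seq I) (Pr : pred I) f :
  mact V (\sum_(i <- s | Pr i) f i) = \sum_(i <- s | Pr i) mact V (f i).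
Proof. by elim/big_rec2: _ => [|i y x _ <-]; rewrite ?mact0 ?mactD. Qed.

Lemma mact_mbasis V x : mact V (mbasis x) = lact V x.
Proof.
rewrite /mact (bigD1 x) //= big1 ?addr0 => [|m ne].
  by rewrite mxE !eqxx scale1r.
by rewrite mxE (inj_eq enum_rank_inj) (negPf ne) scale0r.
Qed.

Lemma mact_lreg V m a : mact V (lreg m *m a) = lact V m *m mact V a.
Proof.
rewrite {1}(mbasis_decomp a) mulmx_sumr mact_sum [in RHS]/mact mulmx_sumr.
apply: eq_bigr => x _; rewrite -!scalemxAr lreg_mbasis mactZ.
by rewrite mact_mbasis lactM.
Qed.

Lemma intertwiner_mact V W B a :
  @intertwiner V W B -> B *m mact V a = mact W a *m B.
Proof.
move=> hB; rewrite /mact mulmx_sumr mulmx_suml.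
by apply: eq_bigr => m _; rewrite -scalemxAr hB scalemxAl.
Qed.

Lemma regular_hom W (B : 'M[R]_(ldim W, #|M|)) a :
  (forall m, B *m lreg m = lact W m *m B) ->
  B *m a = mact W a *m (B *m mbasis 1%g).
Proof.
move=> hB; rewrite {1}(mbasis_decomp a) mulmx_sumr mulmx_suml.
apply: eq_bigr => m _; rewrite -scalemxAr -scalemxAl mulmxA -hB -mulmxA.
by rewrite lreg_mbasis mulg1.
Qed.

Lemma mact_endo V E a : endo E -> mact V (E *m a) = mact V a *m ev V E.
Proof.
move=> hE; rewrite {1}(mbasis_decomp a) mulmx_sumr mact_sum [in RHS]/mact mulmx_suml.
apply: eq_bigr => m _; rewrite -scalemxAr mactZ -scalemxAl -[m in mbasis m]mulg1.
by rewrite -lreg_mbasis mulmxA hE -mulmxA mact_lreg.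
Qed.

Lemma evM V E E' : endo E -> ev V (E *m E') = ev V E' *m ev V E.
Proof. by move=> hE; rewrite /ev -mulmxA mact_endo. Qed.

Lemma ev_idem E : endo E -> E *m E = E ->
  forall V, ev V E *m ev V E = ev V E.
Proof. by move=> hE EE V; rewrite -evM // EE. Qed.

Lemma evD V E E' : ev V (E + E') = ev V E + ev V E'.
Proof. by rewrite /ev mulmxDl mactD. Qed.

Lemma ev0 V : ev V 0 = 0.
Proof. by rewrite /ev mul0mx mact0. Qed.

Lemma endoM E E' : endo E -> endo E' -> endo (E *m E').
Proof. by move=> hE hE' m; rewrite -mulmxA hE' mulmxA hE mulmxA. Qed.

Lemma endoD E E' : endo E -> endo E' -> endo (E + E').
Proof. by move=> hE hE' m; rewrite mulmxDl mulmxDr hE hE'. Qed.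

Lemma endoB E E' : endo E -> endo E' -> endo (E - E').
Proof. by move=> hE hE' m; rewrite mulmxBl mulmxBr hE hE'. Qed.

Lemma endo1 : endo 1%:M.
Proof. by move=> m; rewrite mul1mx mulmx1. Qed.

Lemma endo_mact E a : endo E ->
  E *m mact (regular_lmod R M) a = mact (regular_lmod R M) a *m E.
Proof. exact: (@intertwiner_mact (regular_lmod R M) (regular_lmod R M)). Qed.

Lemma endo_act E a : endo E ->
  E *m a = \sum_(m : M) a (enum_rank m) 0 *: (lreg m *m (E *m mbasis 1%g)).
Proof.
move=> hE; rewrite {1}(mbasis_decomp a) mulmx_sumr; apply: eq_bigr => m _.
by rewrite -scalemxAr -[m in mbasis m]mulg1 -lreg_mbasis !mulmxA hE.
Qed.

(** The homomorphism from RM to [W] that sends the identity of [M] to [w]; homomorphisms out of the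
    free module of rank one are all of this form. *)
Definition orbit_mx W (w : 'cV[R]_(ldim W)) : 'M[R]_(ldim W, #|M|) :=
  \matrix_(i, j) (lact W (enum_val j) *m w) i 0.

Lemma orbit_mx_mbasis W (w : 'cV[R]_(ldim W)) x :
  orbit_mx w *m mbasis x = lact W x *m w.
Proof. by rewrite -colE; apply/colP=> i; rewrite !mxE enum_rankK. Qed.

Lemma mulmx_basis m (B B' : 'M[R]_(m, #|M|)) :
  (forall x, B *m mbasis x = B' *m mbasis x) -> B = B'.
Proof.
move=> h; apply/matrixP=> i j; have := h (enum_val j).
by rewrite /mbasis enum_valK -!colE => /colP/(_ i); rewrite !mxE.
Qed.

Lemma orbit_mxP W (w : 'cV[R]_(ldim W)) m :
  orbit_mx w *m lreg m = lact W m *m orbit_mx w.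
Proof.
apply: mulmx_basis => x.
by rewrite -!mulmxA lreg_mbasis !orbit_mx_mbasis lactM mulmxA.
Qed.

Lemma orbit_mxE W (w : 'cV[R]_(ldim W)) a : orbit_mx w *m a = mact W a *m w.
Proof.
by rewrite (regular_hom _ (orbit_mxP w)) orbit_mx_mbasis lact1 mul1mx.
Qed.

End Action.

(** * Compatibility of the action with base change *)

Section BaseChangeAction.
Variables (R R' : comNzRingType) (phi : {rmorphism R -> R'}).
Variable M : finMonoidType.

Lemma map_lreg (m : M) : map_mx phi (lreg R m) = lreg R' m.
Proof. by apply/matrixP=> i j; rewrite !mxE rmorph_nat. Qed.

Lemma map_mbasis (x : M) : map_mx phi (mbasis R x) = mbasis R' x.
Proof. exact: map_delta_mx. Qed.

Lemma map_endo (E : 'M[R]_#|M|) : endo E -> endo (map_mx phi E).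
Proof. by move=> hE m; rewrite -map_lreg -!map_mxM hE. Qed.

Lemma map_mact (V : lmod R M) a :
  map_mx phi (mact V a) = mact (base_change phi V) (map_mx phi a).
Proof.
rewrite /mact [LHS](raddf_sum (map_mx phi)); apply: eq_bigr => m _.
by rewrite /= map_mxZ mxE.
Qed.

Lemma map_ev (V : lmod R M) E :
  map_mx phi (ev V E) = ev (base_change phi V) (map_mx phi E).
Proof. by rewrite map_mact map_mxM map_mbasis. Qed.

Lemma map_mact_regular a :
  map_mx phi (mact (regular_lmod R M) a) =
  mact (regular_lmod R' M) (map_mx phi a).
Proof.
rewrite map_mact; apply: eq_bigr => m _; congr (_ *: _); exact: map_lreg.
Qed.

End BaseChangeAction.

(** * Linear maps as matrices, and splittings of idempotents *)

Section MatrixOfHom.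
Variable F : fieldType.
Implicit Types m n q : nat.

Definition hom_mx m n (f : 'Hom('cV[F]_m, 'cV[F]_n)) : 'M[F]_(n, m) :=
  \matrix_(i, j) f (delta_mx j 0) i 0.

Definition mx_hom m n (B : 'M[F]_(n, m)) : 'Hom('cV[F]_m, 'cV[F]_n) :=
  linfun (mulmx B).

Lemma hom_mxE m n (f : 'Hom('cV[F]_m, 'cV[F]_n)) v : f v = hom_mx f *m v.
Proof.
have -> : v = \sum_j v j 0 *: delta_mx j 0.
  by rewrite [LHS]matrix_sum_delta; apply: eq_bigr => i _; rewrite big_ord1.
rewrite linear_sum mulmx_sumr; apply: eq_bigr => j _.
rewrite linearZ -scalemxAr -colE; congr (_ *: _).
by apply/colP=> i; rewrite !mxE.
Qed.

Lemma mx_homE m n (B : 'M[F]_(n, m)) v : mx_hom B v = B *m v.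
Proof. by rewrite lfunE. Qed.

Lemma eq_mulmx_col m n (B B' : 'M[F]_(n, m)) :
  (forall v : 'cV_m, B *m v = B' *m v) -> B = B'.
Proof.
move=> h; apply/matrixP=> i j.
by have := h (delta_mx j 0); rewrite -!colE => /colP/(_ i); rewrite !mxE.
Qed.

Lemma hom_mxK m n (B : 'M[F]_(n, m)) : hom_mx (mx_hom B) = B.
Proof. by apply: eq_mulmx_col => v; rewrite -hom_mxE mx_homE. Qed.

Lemma hom_mx_comp m n q (g : 'Hom('cV[F]_n, 'cV[F]_q))
  (f : 'Hom('cV[F]_m, 'cV[F]_n)) : hom_mx (g \o f)%VF = hom_mx g *m hom_mx f.
Proof.
by apply: eq_mulmx_col => v; rewrite -hom_mxE comp_lfunE -mulmxA -!hom_mxE.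
Qed.

Lemma lker0_mx m n (f : 'Hom('cV[F]_m, 'cV[F]_n)) :
  lker f = 0%VS -> exists B, B *m hom_mx f = 1%:M.
Proof.
move=> /eqP kf; exists (hom_mx f^-1)%VF; apply: eq_mulmx_col => v.
by rewrite -mulmxA -!hom_mxE mul1mx lker0_lfunK.
Qed.

Lemma limgf_mx m n (f : 'Hom('cV[F]_m, 'cV[F]_n)) :
  limg f = fullv -> exists B, hom_mx f *m B = 1%:M.
Proof.
move=> imf; exists (hom_mx f^-1)%VF; apply: eq_mulmx_col => v.
by rewrite -mulmxA -!hom_mxE mul1mx limg_lfunVK // imf memvf.
Qed.

Lemma mx_lker0 m n (B : 'M[F]_(n, m)) (B' : 'M[F]_(m, n)) :
  B' *m B = 1%:M -> lker (mx_hom B) = 0%VS.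
Proof.
move=> BB; apply/eqP/lker0P => u v; rewrite !mx_homE => e.
by rewrite -[u]mul1mx -[v]mul1mx -BB -!mulmxA e.
Qed.

Lemma mx_limgf m n (B : 'M[F]_(n, m)) (B' : 'M[F]_(m, n)) :
  B *m B' = 1%:M -> limg (mx_hom B) = fullv.
Proof.
move=> BB; apply/vspaceP=> v; rewrite memvf; apply/memv_imgP.
by exists (B' *m v); rewrite ?memvf // mx_homE mulmxA BB mul1mx.
Qed.

Lemma idem_factor n q (B : 'M[F]_(n, q)) (B' : 'M[F]_(q, n)) :
  row_full B -> row_free B' -> B *m B' *m (B *m B') = B *m B' ->
  B' *m B = 1%:M.
Proof.
move=> /row_fullP[C CB] /row_freeP[C' B'C] BB.
have -> : B' *m B = C *m (B *m B' *m (B *m B')) *m C'.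
  by rewrite !mulmxA CB mul1mx -!mulmxA B'C mulmx1.
by rewrite BB mulmxA CB mul1mx.
Qed.

Lemma idem_split n (p : 'M[F]_n) : p *m p = p ->
  exists r (B : 'M[F]_(n, r)) (B' : 'M[F]_(r, n)),
    [/\ B *m B' = p, B' *m B = 1%:M & r = \rank p].
Proof.
move=> pp; exists (\rank p), (col_base p), (row_base p).
split=> //; first exact: mulmx_base.
apply: idem_factor (col_base_full p) (row_base_free p) _.
by rewrite mulmx_base.
Qed.

Lemma idem_rank_mxtrace n (p : 'M[F]_n) : p *m p = p -> \tr p = (\rank p)%:R.
Proof.
move=> /idem_split[r [B [B' [e BB <-]]]].
by rewrite -e mxtrace_mulC BB mxtrace1.
Qed.

End MatrixOfHom.

(** * Modules as matrix representations *)

Section Modules.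
Variables (F : fieldType) (M : finMonoidType).
Implicit Types U V W P S : lmod F M.
Local Notation vec V := 'cV[F]_(ldim V).

Lemma is_homP V W (f : 'Hom(vec V, vec W)) :
  is_hom f <-> intertwiner (hom_mx f).
Proof.
split=> h m.
  by apply: eq_mulmx_col => v; rewrite -!mulmxA -!hom_mxE h hom_mxE.
by move=> v; rewrite !hom_mxE mulmxA h mulmxA.
Qed.

Lemma intertwiner_id V : @intertwiner F M V V 1%:M.
Proof. by move=> m; rewrite mul1mx mulmx1. Qed.

Lemma intertwinerM U V W (C : 'M_(ldim W, ldim V)) (B : 'M_(ldim V, ldim U)) :
  intertwiner C -> intertwiner B -> @intertwiner F M U W (C *m B).
Proof. by move=> hC hB m; rewrite -mulmxA hB mulmxA hC mulmxA. Qed.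

Lemma intertwiner_inv V W (B : 'M[F]_(ldim W, ldim V)) B' :
  intertwiner B -> B' *m B = 1%:M -> B *m B' = 1%:M ->
  @intertwiner F M W V B'.
Proof.
move=> hB B'B BB' m.
by rewrite -[lact W m]mulmx1 -BB' (mulmxA _ B) -hB !mulmxA B'B mul1mx.
Qed.

Lemma isomorphicP V W : isomorphic V W <->
  exists B B', [/\ @intertwiner F M V W B, B' *m B = 1%:M & B *m B' = 1%:M].
Proof.
split=> [[f [hf kf] [_ imf]]|[B [B' [hB B'B BB']]]].
  have [B' BB'] := lker0_mx kf; have [B'' BB''] := limgf_mx imf.
  exists (hom_mx f), B'; split=> //; first exact/is_homP.
  by rewrite -[B' in LHS]mulmx1 -BB'' (mulmxA B') BB' mul1mx.
have hf : is_hom (mx_hom B) by apply/is_homP; rewrite hom_mxK.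
exists (mx_hom B); split=> //; first exact: mx_lker0 B'B.
exact: mx_limgf BB'.
Qed.

Lemma isomorphic_sym V W : isomorphic V W -> isomorphic W V.
Proof.
move=> /isomorphicP[B [B' [hB B'B BB']]]; apply/isomorphicP.
by exists B', B; split=> //; apply: intertwiner_inv hB _ _.
Qed.

Lemma split_exact_mul0 m n q (B : 'M[F]_(n, m)) B' (C : 'M[F]_(q, n)) C' :
  B' *m B = 1%:M -> C *m C' = 1%:M -> B *m B' + C' *m C = 1%:M -> C *m B = 0.
Proof.
move=> B'B CC' BC.
have : B *m B' *m B + C' *m C *m B = B by rewrite -mulmxDl BC mul1mx.
rewrite -!mulmxA B'B mulmx1 => /(canRL (addKr _)); rewrite addNr => e.
by rewrite -[C in LHS]mul1mx -CC' -!mulmxA e mulmx0.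
Qed.

(** Every exact sequence splits linearly over a field: [B'] and [C'] are linear maps only, not
    homomorphisms, and exactness in the middle becomes one matrix equation. *)
Lemma short_exactP U V W : short_exact U V W <->
  exists (B : 'M_(ldim V, ldim U)) B' (C : 'M_(ldim W, ldim V)) C',
  [/\ intertwiner B, intertwiner C, B' *m B = 1%:M, C *m C' = 1%:M
    & B *m B' + C' *m C = 1%:M].
Proof.
split=> [[f [g [[hf kf] [hg img] fg]]]|[B [B' [C [C' [hB hC B'B CC' BC]]]]]].
  have [B' BB'] := lker0_mx kf; have [C' CC'] := limgf_mx img.
  have gf : hom_mx g *m hom_mx f = 0.
    apply: eq_mulmx_col => v; rewrite -mulmxA -!hom_mxE mul0mx.
    by apply/eqP; rewrite -memv_ker -fg memv_img ?memvf.
  (* An arbitrary left inverse [B'] need not vanish on the image of [C']; projecting away from that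
     image first makes it do so. *)
  exists (hom_mx f), (B' *m (1%:M - C' *m hom_mx g)), (hom_mx g), C'; split=> //.
  - exact/is_homP.
  - exact/is_homP.
  - by rewrite -mulmxA mulmxBl mul1mx -mulmxA gf mulmx0 subr0.
  suff -> : hom_mx f *m (B' *m (1%:M - C' *m hom_mx g)) = 1%:M - C' *m hom_mx g.
    by rewrite subrK.
  apply: eq_mulmx_col => v; rewrite -!mulmxA.
  have : (1%:M - C' *m hom_mx g) *m v \in limg f.
    rewrite fg memv_ker hom_mxE mulmxA mulmxBr mulmx1 mulmxA CC' mul1mx subrr.
    by rewrite mul0mx.
  by case/memv_imgP=> u _ ->; rewrite hom_mxE (mulmxA B') BB' mul1mx.
have CB := split_exact_mul0 B'B CC' BC.
exists (mx_hom B), (mx_hom C); split.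
- by split; [apply/is_homP; rewrite hom_mxK|apply: mx_lker0 B'B].
- by split; [apply/is_homP; rewrite hom_mxK|apply: mx_limgf CC'].
apply/vspaceP=> v; rewrite memv_ker mx_homE.
apply/memv_imgP/eqP => [[u _ ->]|Cv].
  by rewrite mx_homE mulmxA CB mul0mx.
exists (B' *m v); rewrite ?memvf // mx_homE -[LHS]mul1mx -BC mulmxDl.
by rewrite -(mulmxA C') Cv mulmx0 addr0 mulmxA.
Qed.

(** Rank-nullity for [C] restricted to the image of the idempotent. Its image there is that of [a]
    on [W], since [C] is onto. A vector of the kernel is fixed by [a] and comes from [U], hence from
    the image of [a] on [U]. The matrices are transposed because subspaces are row spaces. *)
Lemma rank_mact_ses U V W a : short_exact U V W ->
  mact V a *m mact V a = mact V a ->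
  \rank (mact V a) = (\rank (mact U a) + \rank (mact W a))%N.
Proof.
move=> /short_exactP[B [B' [C [C' [hB hC B'B CC' BC]]]]] EE.
have CB := split_exact_mul0 B'B CC' BC.
have := intertwiner_mact a hB; have := intertwiner_mact a hC.
move: (mact U a) (mact V a) (mact W a) EE => EU E EW EE CE BE.
rewrite -[LHS]mxrank_tr -(mxrank_mul_ker E^T C^T) addnC; congr (_ + _)%N.
  have fB : row_free B^T by apply/row_freeP; exists B'^T; rewrite -trmx_mul B'B trmx1.
  rewrite -[in RHS]mxrank_tr -(mxrankMfree EU^T fB); apply/eqmx_rank.
  rewrite -trmx_mul BE; apply/andP; split; last first.
    by rewrite sub_capmx sub_kermx -trmx_mul mulmxA CE -mulmxA CB mulmx0 trmx0 eqxx
               trmx_mul submxMl.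
  set X := (E^T :&: kermx C^T)%MS.
  have XE : X *m E^T = X.
    have /submxP[Y ->] : (X <= E^T)%MS by exact: capmxSl.
    by rewrite -mulmxA -trmx_mul EE.
  have XC : X *m C^T = 0 by apply/eqP; rewrite -sub_kermx capmxSr.
  rewrite -XE -[X]mulmx1 -trmx1 -BC linearD /= mulmxDr !trmx_mul (mulmxA _ C^T) XC.
  by rewrite mul0mx addr0; apply/submxP; exists (X *m B'^T); rewrite !mulmxA.
rewrite -trmx_mul mxrank_tr CE mxrankMfree //.
by apply/row_freeP; exists C'.
Qed.

End Modules.

(** * Submodules, quotients, Schur's lemma and composition series *)

Section SubQuotients.
Variables (F : fieldType) (M : finMonoidType).
Implicit Types U V W P S : lmod F M.
Local Notation vec V := 'cV[F]_(ldim V).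

(* Covers submodules, quotients and direct summands at once: [B] may be the
   inclusion of a submodule or a section of a quotient map. *)
Section Cut.
Variables (V : lmod F M) (r : nat) (B : 'M[F]_(ldim V, r)).
Variables (B' : 'M[F]_(r, ldim V)) (BB : B' *m B = 1%:M).
Hypothesis cutM : forall x y, B' *m lact V x *m B *m (B' *m lact V y *m B) =
  B' *m (lact V x *m lact V y) *m B.

Fact cut1_subproof : B' *m lact V 1%g *m B = 1%:M.
Proof. by rewrite lact1 mulmx1. Qed.

Fact cutM_subproof x y : B' *m lact V (x * y)%g *m B =
  B' *m lact V x *m B *m (B' *m lact V y *m B).
Proof. by rewrite cutM lactM. Qed.

Definition cut_lmod : lmod F M := LMod cut1_subproof cutM_subproof.

End Cut.

(** The second hypothesis says that the image of [p] is a submodule; [p] itself need not be a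
    homomorphism. [U] is this image, and [W] is the quotient, realised on the image of the
    complementary idempotent. *)
Lemma idem_ses V (p : 'M[F]_(ldim V)) : p *m p = p ->
  (forall m, p *m lact V m *m p = lact V m *m p) ->
  exists U W (B : 'M_(ldim V, ldim U)) B' (C : 'M_(ldim W, ldim V)) C',
  [/\ [/\ intertwiner B, intertwiner C, B' *m B = 1%:M & C *m C' = 1%:M],
      B *m B' = p & C' *m C = 1%:M - p].
Proof.
move=> pp pV.
have [r [B [B' [BB B'B _]]]] := idem_split pp.
have qq : (1%:M - p) *m (1%:M - p) = 1%:M - p.
  by rewrite mulmxBr mulmx1 mulmxBl mul1mx pp subrr subr0.
have Vq m : (1%:M - p) *m lact V m *m (1%:M - p) = (1%:M - p) *m lact V m.
  by rewrite mulmxBr mulmx1 !mulmxBl mul1mx pV subrr subr0.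
have [q [C' [C [C'C CC' _]]]] := idem_split qq.
have pB : p *m B = B by rewrite -BB -mulmxA B'B mulmx1.
have VB m : B *m (B' *m lact V m *m B) = lact V m *m B.
  by rewrite !mulmxA BB -[B in LHS]pB -[B in RHS]pB !mulmxA pV.
have Cq : C *m (1%:M - p) = C by rewrite -C'C mulmxA CC' mul1mx.
have CV m : C *m lact V m *m C' *m C = C *m lact V m.
  by rewrite -mulmxA C'C -{1}Cq -!mulmxA (mulmxA _ (lact V m)) Vq mulmxA Cq.
have hB x y : B' *m lact V x *m B *m (B' *m lact V y *m B) =
  B' *m (lact V x *m lact V y) *m B.
  by rewrite -(mulmxA B') -mulmxA -mulmxA VB !mulmxA.
have hC x y : C *m lact V x *m C' *m (C *m lact V y *m C') =
  C *m (lact V x *m lact V y) *m C'.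
  by rewrite (mulmxA _ (C *m lact V y)) (mulmxA _ C) CV !mulmxA.
exists (cut_lmod B'B hB), (cut_lmod CC' hC), B, B', C, C'.
by split=> //; split=> // m; rewrite /= ?VB ?CV.
Qed.

Lemma submod_idem V (X : {vspace vec V}) : is_submod X ->
  exists p : 'M[F]_(ldim V), [/\ p *m p = p,
    forall m, p *m lact V m *m p = lact V m *m p
  & forall v : vec V, v \in X <-> p *m v = v].
Proof.
move=> hX; pose p := hom_mx (projv X).
have pX v : p *m v \in X by rewrite -hom_mxE memv_proj.
have Xp v : v \in X -> p *m v = v by move=> Xv; rewrite -hom_mxE projv_id.
exists p; split=> [|m|v]; last by split=> [/Xp|<-].
  by apply: eq_mulmx_col => v; rewrite -mulmxA Xp.
by apply: eq_mulmx_col => v; rewrite -!mulmxA Xp // hX.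
Qed.

Lemma submod_img V W (B : 'M[F]_(ldim W, ldim V)) (X : {vspace vec V}) :
  intertwiner B -> is_submod X -> is_submod (V := W) (mx_hom B @: X)%VS.
Proof.
move=> hB hX m v /memv_imgP[u Xu ->].
by rewrite mx_homE mulmxA -hB -mulmxA -mx_homE memv_img // hX.
Qed.

Lemma submod_preim V W (B : 'M[F]_(ldim W, ldim V)) (Y : {vspace vec W}) :
  intertwiner B -> is_submod (V := W) Y ->
  is_submod (V := V) (mx_hom B @^-1: Y)%VS.
Proof.
move=> hB hY m v; rewrite -!memv_preim !mx_homE => Yv.
by rewrite mulmxA hB -mulmxA hY.
Qed.

Lemma submod_full V : is_submod (V := V) fullv.
Proof. by move=> m v _; rewrite memvf. Qed.

Lemma submod0 V : is_submod (V := V) 0%VS.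
Proof. by move=> m v; rewrite memv0 => /eqP->; rewrite mulmx0 mem0v. Qed.

Lemma hom_to_simple V W (B : 'M[F]_(ldim W, ldim V)) : simple_lmod W ->
  intertwiner B -> B != 0 -> exists B', B *m B' = 1%:M.
Proof.
move=> [_ sW] hB B0; have := submod_img hB (@submod_full V).
case/sW => [e|/limgf_mx]; last by rewrite hom_mxK.
case/eqP: B0; apply: eq_mulmx_col => v; rewrite mul0mx -mx_homE.
by apply/eqP; rewrite -memv0 -e memv_img ?memvf.
Qed.

Lemma hom_from_simple V W (B : 'M[F]_(ldim W, ldim V)) : simple_lmod V ->
  intertwiner B -> B != 0 -> exists B', B' *m B = 1%:M.
Proof.
move=> [_ sV] hB B0; have := submod_preim hB (@submod0 W).
case/sV => e.
  have /lker0_mx : lker (mx_hom B) = 0%VS.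
    by apply/vspaceP=> v; rewrite -e memv_ker -memv_preim memv0.
  by rewrite hom_mxK.
case/eqP: B0; apply: eq_mulmx_col => v; rewrite mul0mx -mx_homE.
by apply/eqP; rewrite -memv0 memv_preim e memvf.
Qed.

Lemma mx_inv_eq m n (B : 'M[F]_(m, n)) B' B'' :
  B *m B' = 1%:M -> B'' *m B = 1%:M -> B'' = B'.
Proof. by move=> BB' BB''; rewrite -[B'']mulmx1 -BB' mulmxA BB'' mul1mx. Qed.

Lemma schur V W (B : 'M[F]_(ldim W, ldim V)) :
  simple_lmod V -> simple_lmod W -> intertwiner B -> B != 0 ->
  exists B', B' *m B = 1%:M /\ B *m B' = 1%:M.
Proof.
move=> sV sW hB B0; have [B' BB'] := hom_to_simple sW hB B0.
have [B'' BB''] := hom_from_simple sV hB B0.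
by exists B'; split=> //; rewrite -(mx_inv_eq BB' BB'').
Qed.

Lemma mx0_dim m n (B : 'M[F]_(m, n)) : m = 0%N -> B = 0.
Proof. by move=> m0; apply/matrixP=> i; have := ltn_ord i; rewrite {2}m0. Qed.

Lemma mul1_neq0 m n (B : 'M[F]_(m, n)) B' :
  B *m B' = 1%:M -> (0 < m)%N -> B != 0 /\ B' != 0.
Proof.
move=> BB' m0; split; apply/eqP=> e; move: BB'; rewrite e (mul0mx, mulmx0) => /matrixP;
move=> /(_ (Ordinal m0) (Ordinal m0)); rewrite !mxE eqxx => /eqP;
by rewrite eq_sym oner_eq0.
Qed.

Lemma simple_isomorphic V W : isomorphic V W -> simple_lmod V -> simple_lmod W.
Proof.
move=> /isomorphicP[B [B' [hB B'B BB']]] sV; split.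
  case: (posnP (ldim W)) => // /(mx0_dim B) B0.
  have [_] := mul1_neq0 B'B sV.1; by rewrite B0 eqxx.
move=> Y hY; have [e|e] := sV.2 _ (submod_preim hB hY); [left|right].
  apply/eqP; rewrite -subv0; apply/subvP => w Yw; rewrite memv0.
  have : B' *m w \in (mx_hom B @^-1: Y)%VS.
    by rewrite -memv_preim mx_homE mulmxA BB' mul1mx.
  by rewrite e memv0 => /eqP Bw; rewrite -[w]mul1mx -BB' -mulmxA Bw mulmx0.
apply/vspaceP=> w; rewrite memvf -[w]mul1mx -BB' -mulmxA -mx_homE memv_preim e.
exact: memvf.
Qed.

Lemma dim_cV n : \dim {:'cV[F]_n} = n.
Proof. by rewrite dimvf dim_matrix mulr1. Qed.

Lemma maximal_submod_exists V : (0 < ldim V)%N ->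
  exists X : {vspace vec V}, maximal_submod X.
Proof.
move=> V0; pose A n := `[< exists X : {vspace vec V},
  [/\ is_submod X, X <> fullv & \dim X = n] >].
have exA : exists n, A n.
  exists 0%N; apply/asboolP; exists 0%VS; split; [exact: submod0| |exact: dimv0].
  move=> /(congr1 (fun X : {vspace vec V} => \dim X)); rewrite dimv0 dim_cV => e.
  by rewrite -e in V0.
have ubA n : A n -> (n <= ldim V)%N.
  case/asboolP=> X [_ _ <-]; rewrite (leq_trans (dimvS (subvf X))) //.
  by rewrite dim_cV.
case: (ex_maxnP exA ubA) => n /asboolP[X [hX Xf dX]] nmax.
exists X; split=> // Y hY XY; have [->|/eqP nY] := eqVneq Y fullv; [by right|left].
apply/eqP; rewrite eq_sym eqEdim XY dX nmax //.
by apply/asboolP; exists Y; split=> //; apply/eqP.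
Qed.

Lemma maximal_submod_quotient V (X : {vspace vec V}) : maximal_submod X ->
  exists U W (B : 'M_(ldim V, ldim U)) B' (C : 'M_(ldim W, ldim V)) C',
  [/\ [/\ intertwiner B, intertwiner C, B' *m B = 1%:M & C *m C' = 1%:M],
      B *m B' + C' *m C = 1%:M, simple_lmod W
    & forall v, v \in X <-> C *m v = 0].
Proof.
case=> hX Xf Xmax; have [p [pp pV Xp]] := submod_idem hX.
have [U [W [B [B' [C [C' [[hB hC BB CC] BB' CC']]]]]]] := idem_ses pp pV.
have XC v : v \in X <-> C *m v = 0.
  rewrite Xp; split=> [<-|Cv].
    have: C *m (1%:M - p) = C by rewrite -CC' mulmxA CC mul1mx.
    move=> /eqP; rewrite mulmxBr mulmx1 -subr_eq0 addrAC subrr add0r oppr_eq0.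
    by move=> /eqP Cp; rewrite mulmxA Cp mul0mx.
  apply/eqP; rewrite eq_sym -subr_eq0 -[v in v - _]mul1mx -mulmxBl -CC'.
  by rewrite -mulmxA Cv mulmx0.
exists U, W, B, B', C, C'; split=> //; first by rewrite BB' CC' addrC subrK.
split.
  case: (posnP (ldim W)) => // /(mx0_dim C) C0; case: Xf; apply/vspaceP=> v.
  by rewrite memvf; apply/XC; rewrite C0 mul0mx.
move=> Y hY; have [|e|e] := Xmax _ (submod_preim hC hY).
- apply/subvP=> v /XC Cv; rewrite -memv_preim mx_homE Cv; exact: mem0v.
- left; apply/eqP; rewrite -subv0; apply/subvP=> w Yw.
  have /XC : C' *m w \in X by rewrite -e -memv_preim mx_homE mulmxA CC mul1mx.
  by rewrite mulmxA CC mul1mx => ->; rewrite mem0v.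
right; apply/vspaceP=> w; rewrite memvf -[w]mul1mx -CC -mulmxA -mx_homE memv_preim e.
exact: memvf.
Qed.

Lemma composition_factors_exist V : exists s, composition_factors V s.
Proof.
have [n leVn] := ubnP (ldim V); elim: n V leVn => // n IHn V leVn.
have [V0|V0] := posnP (ldim V); first by exists [::]; apply: CompNil.
have [X maxX] := maximal_submod_exists V0.
have [U [W [B [B' [C [C' [[hB hC BB CC] BC sW XC]]]]]]] := maximal_submod_quotient maxX.
have ses : short_exact U V W by apply/short_exactP; exists B, B', C, C'.
(* Additivity of dimensions is additivity of ranks for the idempotent 1 of the algebra. *)
have dV : \rank (mact V (mbasis F 1%g)) = ldim V.
  by rewrite mact_mbasis lact1 mxrank1.
have : \rank (mact V (mbasis F 1%g)) = (ldim U + ldim W)%N.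
  rewrite (rank_mact_ses ses); last by rewrite mact_mbasis lact1 mulmx1.
  by rewrite !mact_mbasis !lact1 !mxrank1.
rewrite dV => e; have [|s hs] := IHn U.
  by rewrite -ltnS (leq_trans _ leVn) // ltnS e -[X in (X < _)%N]addn0 ltn_add2l sW.1.
by exists (W :: s); apply: CompCons ses sW hs.
Qed.

End SubQuotients.

(** * Projective indecomposable modules *)

Section Projectives.
Variables (F : fieldType) (M : finMonoidType).
Implicit Types U V W P S : lmod F M.
Local Notation vec V := 'cV[F]_(ldim V).
Local Notation reg := (regular_lmod F M).

Lemma mx_homM m n q (A : 'M[F]_(q, n)) (B : 'M[F]_(n, m)) :
  mx_hom (A *m B) = (mx_hom A \o mx_hom B)%VF.
Proof. by apply/lfunP=> v; rewrite comp_lfunE !mx_homE mulmxA. Qed.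

Lemma limg_mx_hom0 m n (A : 'M[F]_(n, m)) : limg (mx_hom A) = 0%VS -> A = 0.
Proof.
move=> e; apply: eq_mulmx_col => v; rewrite mul0mx -mx_homE.
by apply/eqP; rewrite -memv0 -e memv_img ?memvf.
Qed.

Lemma limg_submod V W (A : 'M[F]_(ldim W, ldim V)) :
  intertwiner A -> is_submod (V := W) (limg (mx_hom A)).
Proof. by move=> hA; apply: submod_img hA _; apply: submod_full. Qed.

Lemma lker_submod V W (A : 'M[F]_(ldim W, ldim V)) :
  intertwiner A -> is_submod (V := V) (lker (mx_hom A)).
Proof.
move=> hA m v; rewrite !memv_ker !mx_homE mulmxA hA -mulmxA => /eqP->.
by rewrite mulmx0.
Qed.

Lemma dim_limg_full m n (A : 'M[F]_(n, m)) :
  (n <= \dim (limg (mx_hom A)))%N -> exists B, A *m B = 1%:M.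
Proof.
move=> le; rewrite -[A]hom_mxK; apply: limgf_mx; apply/eqP.
by rewrite eqEdim subvf dim_cV.
Qed.

(* Fitting's lemma in disguise: among the endomorphisms compatible with [C]
   take one of minimal rank; its image and kernel are complementary. *)
Lemma indec_retract P q (C : 'M[F]_(q, ldim P)) (H : 'M_(ldim P)) :
  indecomposable P -> C != 0 -> @intertwiner F M P P H -> C *m H = C ->
  exists H', [/\ H' *m H = 1%:M, H *m H' = 1%:M & @intertwiner F M P P H'].
Proof.
move=> [P0 indP] C0 hH CH.
pose A n := `[< exists K : 'M_(ldim P), [/\ @intertwiner F M P P K, C *m K = C
  & \dim (limg (mx_hom K)) = n] >].
have exA : exists n, A n by exists (\dim (limg (mx_hom H))); apply/asboolP; exists H.
case: (ex_minnP exA) => n /asboolP[K [hK CK dK]] nmin.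
have capK : (limg (mx_hom K) :&: lker (mx_hom K))%VS = 0%VS.
  apply/eqP; rewrite -dimv_eq0 -leqn0.
  rewrite -(leq_add2r (\dim (mx_hom K @: limg (mx_hom K)))) limg_ker_dim add0n.
  rewrite -limg_comp -mx_homM dK nmin //.
  by apply/asboolP; exists (K *m K); split; rewrite ?mulmxA ?CK //; apply: intertwinerM.
have addK : (limg (mx_hom K) + lker (mx_hom K))%VS = fullv.
  apply/eqP; rewrite eqEdim subvf dimv_disjoint_sum //.
  rewrite -(limg_ker_dim (mx_hom K) fullv) capfv addnC; exact: leqnn.
have invH : exists H', H *m H' = 1%:M.
  apply: dim_limg_full; apply: leq_trans (nmin _ _); last first.
    by apply/asboolP; exists H.
  have [/limg_mx_hom0 K0|k0] := indP _ _ (limg_submod hK) (lker_submod hK) addK capK.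
    by rewrite K0 mulmx0 in CK; rewrite CK eqxx in C0.
  have := limg_ker_dim (mx_hom K) fullv.
  by rewrite k0 capv0 dimv0 add0n dK dim_cV => ->.
case: invH => H' HH'; have H'H := mulmx1C HH'.
by exists H'; split=> //; apply: intertwiner_inv hH _ _.
Qed.

Lemma indec_idem V (p : 'M[F]_(ldim V)) : indecomposable V -> p *m p = p ->
  @intertwiner F M V V p -> p = 0 \/ p = 1%:M.
Proof.
move=> iV pp hp; have [|p0] := eqVneq p 0; [by left|right].
have [H' [_ HH' _]] := indec_retract iV p0 hp pp.
by rewrite -[p]mulmx1 -[in LHS]HH' mulmxA pp.
Qed.

Lemma complement_idem V (X Y : {vspace vec V}) : is_submod X -> is_submod Y ->
  (X + Y)%VS = fullv -> (X :&: Y)%VS = 0%VS ->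
  exists p : 'M[F]_(ldim V), [/\ @intertwiner F M V V p,
    forall v, p *m v \in X, {in X, forall v, p *m v = v}
    & {in Y, forall v, p *m v = 0}].
Proof.
move=> hX hY XY XY0; pose p := hom_mx (daddv_pi X Y).
have pX : {in X, forall v, p *m v = v}.
  by move=> v Xv; rewrite -hom_mxE daddv_pi_id.
have pY : {in Y, forall v, p *m v = 0}.
  move=> v Yv; have := daddv_pi_add (w := v) XY0; rewrite XY memvf => /(_ isT).
  rewrite (daddv_pi_id (U := Y)) 1?capvC // hom_mxE -/p => /(canRL (addrK _)).
  by rewrite subrr.
exists p; split=> // [m|v]; last by rewrite -hom_mxE memv_pi.
apply: eq_mulmx_col => v; rewrite -!mulmxA.
have : v \in (X + Y)%VS by rewrite XY memvf.
case/memv_addP=> x Xx [y Yy ->].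
rewrite !mulmxDr (pX x) // (pY y) // mulmx0 addr0.
by rewrite pX ?hX // pY ?hY // addr0.
Qed.

Lemma not_indec_idem V : (0 < ldim V)%N -> ~ indecomposable V ->
  exists p : 'M[F]_(ldim V), [/\ p *m p = p, @intertwiner F M V V p,
    p != 0 & p != 1%:M].
Proof.
move=> V0 nV; apply: contrapT => np; apply: nV; split=> // X Y hX hY XY XY0.
have [p [hp pinX pX pY]] := complement_idem hX hY XY XY0.
apply: contrapT => /not_orP[/eqP Xn /eqP Yn]; apply: np; exists p; split=> //.
- by apply: eq_mulmx_col => v; rewrite -mulmxA pX.
- apply: contra Xn => /eqP p0; rewrite -subv0; apply/subvP=> v /pX <-.
  by rewrite p0 mul0mx mem0v.
apply: contra Yn => /eqP p1; rewrite -subv0; apply/subvP=> v /pY.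
by rewrite p1 mul1mx => ->; rewrite mem0v.
Qed.

Lemma projective_lift P V W (g : 'M_(ldim W, ldim V)) g' (f : 'M_(ldim W, ldim P)) :
  projective P -> intertwiner g -> g *m g' = 1%:M -> intertwiner f ->
  exists2 h : 'M[F]_(ldim V, ldim P), intertwiner h & g *m h = f.
Proof.
move=> pP hg gg' hf; have [||h hh gh] := pP V W (mx_hom g) (mx_hom f).
- by split; [apply/is_homP; rewrite hom_mxK|apply: mx_limgf gg'].
- by apply/is_homP; rewrite hom_mxK.
exists (hom_mx h); first exact/is_homP.
by rewrite -[g]hom_mxK -hom_mx_comp gh hom_mxK.
Qed.

Lemma factor_intertwiner U V W (f : 'M[F]_(ldim V, ldim U)) f'
  (g : 'M_(ldim W, ldim U)) : intertwiner f -> intertwiner g ->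
  f *m f' = 1%:M -> g *m f' *m f = g -> @intertwiner F M V W (g *m f').
Proof.
move=> hf hg ff' gf m.
rewrite -[lact V m]mulmx1 -ff' (mulmxA _ f) -hf !mulmxA gf.
by rewrite hg -mulmxA.
Qed.

(** If [f'] did not kill the kernel of [f], it would map that kernel onto [W']. Lifting [f'] through
    this surjection gives an endomorphism of [P] with image in the kernel of [f] and compatible with
    [f']. By [indec_retract] it is invertible, so that [f] would vanish. *)
Lemma PIM_simple_factor P W W' (f : 'M[F]_(ldim W, ldim P))
  (f' : 'M[F]_(ldim W', ldim P)) :
  projective P -> indecomposable P -> simple_lmod W -> simple_lmod W' ->
  intertwiner f -> f != 0 -> intertwiner f' -> f' != 0 ->
  exists2 phi : 'M_(ldim W', ldim W), intertwiner phi & f' = phi *m f.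
Proof.
move=> pP iP sW sW' hf f0 hf' f'0.
have [f1 ff1] := hom_to_simple sW hf f0.
pose p := 1%:M - f1 *m f.
have fp : f *m p = 0 by rewrite mulmxBr mulmx1 mulmxA ff1 mul1mx subrr.
have pp : p *m p = p by rewrite {1}/p mulmxBl mul1mx -mulmxA fp mulmx0 subr0.
have pV m : p *m lact P m *m p = lact P m *m p.
  rewrite -mulmxA {1}/p mulmxBl mul1mx -(mulmxA f1) (mulmxA f) hf -(mulmxA _ f).
  by rewrite fp !mulmx0 subr0.
have [U [_ [B [B' [_ [_ [[hB _ B'B _] BB _]]]]]]] := idem_ses pp pV.
have [f'B|f'B] := eqVneq (f' *m B) 0.
  have f'p : f' *m f1 *m f = f'.
    apply/eqP; rewrite eq_sym -subr_eq0 -{1}[f']mulmx1 -mulmxA -mulmxBr -/p.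
    by rewrite -BB mulmxA f'B mul0mx.
  by exists (f' *m f1); first exact: factor_intertwiner hf hf' ff1 f'p.
have hf'B := intertwinerM hf' hB.
have [g' fBg] := hom_to_simple sW' hf'B f'B.
have [h hh f'h] := projective_lift pP hf'B fBg hf'.
rewrite -mulmxA in f'h.
have [H' [_ BH _]] := indec_retract iP f'0 (intertwinerM hB hh) f'h.
case/eqP: f0; have fB : f *m B = 0.
  by rewrite -[B]mulmx1 -B'B (mulmxA B) BB mulmxA fp mul0mx.
by rewrite -[f]mulmx1 -BH !mulmxA fB !mul0mx.
Qed.

Lemma PIM_top P S : projective P -> indecomposable P -> is_top S P ->
  simple_lmod S /\ exists2 g : 'M_(ldim S, ldim P), intertwiner g & g != 0.
Proof.
move=> pP iP [f [hf imf] kerf].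
have [X maxX] := maximal_submod_exists iP.1.
have [_ [W [_ [_ [C [C' [[_ hC _ CC] _ sW XC]]]]]]] := maximal_submod_quotient maxX.
have [C0 _] := mul1_neq0 CC sW.1.
pose g := hom_mx f; have [g' gg'] := limgf_mx imf.
have hg : intertwiner g by apply/is_homP.
(* The quotient map of any maximal submodule factors through [C], so the radical is the kernel of
   [C]. *)
have kg (v : vec P) : g *m v = 0 <-> C *m v = 0.
  rewrite -hom_mxE; split=> [fv|Cv].
    by apply/XC; have /kerf : v \in lker f; [rewrite memv_ker fv|apply].
  apply/eqP; rewrite -memv_ker; apply/kerf => Y maxY.
  have [_ [W' [_ [_ [D [D' [[_ hD _ DD] _ sW' YD]]]]]]] := maximal_submod_quotient maxY.
  have [D0 _] := mul1_neq0 DD sW'.1.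
  have [phi _ e] := PIM_simple_factor pP iP sW sW' hC C0 hD D0.
  by apply/YD; rewrite e -mulmxA Cv mulmx0.
have gC : g *m C' *m C = g.
  apply/eqP; rewrite eq_sym -subr_eq0 -{1}[g]mulmx1 -mulmxA -mulmxBr; apply/eqP.
  apply: eq_mulmx_col => v; rewrite mul0mx -mulmxA; apply/kg.
  by rewrite mulmxA mulmxBr mulmx1 mulmxA CC mul1mx subrr mul0mx.
have Cg : C *m g' *m g = C.
  apply/eqP; rewrite eq_sym -subr_eq0 -{1}[C]mulmx1 -mulmxA -mulmxBr; apply/eqP.
  apply: eq_mulmx_col => v; rewrite mul0mx -mulmxA; apply/kg.
  by rewrite mulmxA mulmxBr mulmx1 mulmxA gg' mul1mx subrr mul0mx.
have sS : simple_lmod S.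
  apply: simple_isomorphic sW; apply/isomorphicP; exists (g *m C'), (C *m g'); split.
  - exact: factor_intertwiner hC hg CC gC.
  - by rewrite mulmxA Cg.
  - by rewrite mulmxA gC.
by split=> //; exists g => //; have [] := mul1_neq0 gg' sS.1.
Qed.

(** Lift the isomorphism of tops in both directions. The two composites are compatible with non-zero
    maps to the tops, hence invertible by [indec_retract]. *)
Lemma isomorphic_top_PIM P P' S S' :
  projective P -> indecomposable P -> is_top S P ->
  projective P' -> indecomposable P' -> is_top S' P' ->
  isomorphic S S' -> isomorphic P P'.
Proof.
move=> pP iP tS pP' iP' tS' /isomorphicP[phi [phi' [hphi phiK phiK']]].
have [sS [g hg g0]] := PIM_top pP iP tS.
have [sS' [g' hg' g'0]] := PIM_top pP' iP' tS'.
pose f := phi *m g; have hf : intertwiner f by apply: intertwinerM.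
have f0 : f != 0.
  apply: contra g0 => /eqP e; by rewrite -[g]mul1mx -phiK -mulmxA -/f e mulmx0.
have [g1 gg1] := hom_to_simple sS' hg' g'0.
have [f1 ff1] := hom_to_simple sS' hf f0.
have [h hh gh] := projective_lift pP hg' gg1 hf.
have [h' hh' fh] := projective_lift pP' hf ff1 hg'.
have [|K [KK _ _]] := indec_retract iP f0 (intertwinerM hh' hh).
  by rewrite mulmxA fh.
have [|K' [_ KK' _]] := indec_retract iP' g'0 (intertwinerM hh hh').
  by rewrite mulmxA gh.
rewrite mulmxA in KK; rewrite -mulmxA in KK'.
apply/isomorphicP; exists h, (K *m h'); split=> //.
by rewrite (mx_inv_eq KK' KK).
Qed.

(** [P] is a direct summand of the regular module. Pick [v] outside the kernel of the map to the
    top: the map 1 |-> [v] followed by [g] is onto, and a lift [h] of [g] through it composes with 1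
    |-> [v] to an automorphism of [P]. *)
Lemma PIM_idem P S : projective P -> indecomposable P -> is_top S P ->
  exists (U : 'M_(#|M|, ldim P)) (V : 'M_(ldim P, #|M|)),
  [/\ V *m U = 1%:M, @intertwiner F M P reg U & @intertwiner F M reg P V].
Proof.
move=> pP iP tS; have [sS [g hg g0]] := PIM_top pP iP tS.
have [v gv] : exists v : vec P, g *m v <> 0.
  apply: contrapT => /forallNP nv; case/eqP: g0; apply: eq_mulmx_col => v.
  by rewrite mul0mx; apply: contrapT.
have hV : @intertwiner F M reg P (orbit_mx v) by exact: orbit_mxP.
have hgV := intertwinerM hg hV.
have gV0 : g *m orbit_mx v != 0.
  apply/eqP=> e; apply: gv.
  by rewrite -[v]mul1mx -(lact1 P) -orbit_mx_mbasis mulmxA e mul0mx.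
have [g' gg'] := hom_to_simple sS hgV gV0.
have [h hh gh] := projective_lift pP hgV gg' hg.
rewrite -mulmxA in gh.
have [K [_ hK iK]] := indec_retract iP g0 (intertwinerM hV hh) gh.
exists (h *m K), (orbit_mx v); split=> //; first by rewrite mulmxA.
exact: intertwinerM.
Qed.

Lemma splitting_mx S (phi : 'M_(ldim S)) : splitting_field F M ->
  simple_lmod S -> @intertwiner F M S S phi -> exists c, phi = c%:M.
Proof.
move=> sp sS hphi; have [|c e] := sp S sS (mx_hom phi).
  by apply/is_homP; rewrite hom_mxK.
exists c; apply: eq_mulmx_col => v.
by rewrite -mx_homE e scale_lfunE id_lfunE mul_scalar_mx.
Qed.

(** For the idempotent e of [P], the space eW is Hom(P, W). It vanishes unless [W] is the top of
    [P]; otherwise the splitting hypothesis makes every homomorphism a multiple of [G], so that eW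
    is the line through [w0]. *)
Lemma rank_ev_PIM P S W (U : 'M_(#|M|, ldim P)) (V : 'M_(ldim P, #|M|)) :
  splitting_field F M -> projective P -> indecomposable P -> is_top S P ->
  V *m U = 1%:M -> @intertwiner F M P reg U -> @intertwiner F M reg P V ->
  simple_lmod W -> \rank (ev W (U *m V)) = `[< isomorphic W S >].
Proof.
move=> sp pP iP tS VU hU hV sW; have [sS [g hg g0]] := PIM_top pP iP tS.
have evE (w : 'cV_(ldim W)) :
    ev W (U *m V) *m w = orbit_mx w *m U *m (V *m mbasis F 1%g).
  by rewrite /ev -orbit_mxE !mulmxA.
have horb (w : 'cV_(ldim W)) : @intertwiner F M P W (orbit_mx w *m U).
  by apply: intertwinerM hU; apply: orbit_mxP.
have [/isomorphicP[phi' [phi [hphi' phiK phiK']]]|nWS] := asboolP; last first.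
  apply/eqP; rewrite mxrank_eq0; apply/eqP; apply: eq_mulmx_col => w.
  rewrite mul0mx evE; have [->|f0] := eqVneq (orbit_mx w *m U) 0.
    by rewrite mul0mx.
  have [phi hphi e] := PIM_simple_factor pP iP sS sW hg g0 (horb w) f0.
  case: nWS; have [|phi' [e1 e2]] := schur sS sW hphi.
    by apply: contra f0 => /eqP phi0; rewrite e phi0 mul0mx.
  by apply/isomorphic_sym/isomorphicP; exists phi, phi'.
have hphi := intertwiner_inv hphi' phiK phiK'.
pose G := phi *m g; have hG : intertwiner G by apply: intertwinerM.
have G0 : G != 0.
  by apply: contra g0 => /eqP e; rewrite -[g]mul1mx -phiK' -mulmxA -/G e mulmx0.
pose w0 := G *m (V *m mbasis F 1%g).
have hGV : @intertwiner F M reg W (G *m V) by apply: intertwinerM.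
have GVa a : G *m V *m a = mact W a *m w0.
  by rewrite (regular_hom _ hGV) /w0 !mulmxA.
have ew0 : ev W (U *m V) *m w0 = w0.
  by rewrite -GVa /w0 !mulmxA -(mulmxA G V U) VU mulmx1.
have w00 : w0 != 0.
  apply: contra G0 => /eqP e; rewrite -[G]mulmx1 -VU; apply/eqP.
  apply: eq_mulmx_col => v; rewrite !mulmxA -(mulmxA (G *m V)) GVa e.
  by rewrite mulmx0 mul0mx.
apply/eqP; rewrite eqn_leq; apply/andP; split; last first.
  rewrite lt0n mxrank_eq0; apply: contra w00 => /eqP e.
  by rewrite -ew0 e mul0mx.
rewrite -mxrank_tr (leq_trans _ (rank_leq_row w0^T)) //; apply: mxrankS.
apply/row_subP=> j; rewrite -tr_col colE evE.
have [->|f0] := eqVneq (orbit_mx (delta_mx j 0) *m U) 0.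
  by rewrite mul0mx trmx0 sub0mx.
have [psi hpsi ->] := PIM_simple_factor pP iP sW sW hG G0 (horb _) f0.
have [c ->] := splitting_mx sp sW hpsi.
by rewrite -mulmxA -/w0 mul_scalar_mx linearZ scalemx_sub.
Qed.

End Projectives.

(** * The rank of an idempotent as a function on the Grothendieck group *)

Section GrothendieckRank.
Variables (F : fieldType) (M : finMonoidType) (E : 'M[F]_#|M|).
Hypotheses (hE : endo E) (EE : E *m E = E).
Implicit Types U V W : lmod F M.

Lemma rank_ev_ses U V W : short_exact U V W ->
  \rank (ev V E) = (\rank (ev U E) + \rank (ev W E))%N.
Proof. by move=> ses; apply: rank_mact_ses ses (ev_idem hE EE V). Qed.

Let frank : {freeg (lmod F M) / int} -> int^o :=
  fglift (fun V => (\rank (ev V E))%:Z : int^o).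

Let frankB : {morph frank : x y / x - y}.
Proof. by move=> x y; apply: lift_is_additive. Qed.

HB.instance Definition _ :=
  GRing.isZmodMorphism.Build {freeg (lmod F M) / int} int^o frank frankB.

Let frankU V : frank << V >> = (\rank (ev V E))%:Z.
Proof. by rewrite /frank liftU scale1r. Qed.

Let frank_rel x : G0_relation x -> frank x = 0.
Proof.
elim=> [|{}x y _ x0 _ y0|U V W ses]; first exact: raddf0.
  by rewrite frankB x0 y0 subrr.
by rewrite !frankB !frankU (rank_ev_ses ses) PoszD addrAC addrK subrr.
Qed.

Lemma G0_rank r V (T : 'I_r -> lmod F M) (D : 'I_r -> int) :
  G0_class V = \sum_(j < r) G0_class (T j) *~ D j ->
  (\rank (ev V E))%:Z = \sum_(j < r) (\rank (ev (T j) E))%:Z * D j.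
Proof.
move=> eV; pose y : {freeg (lmod F M) / int} := \sum_(j < r) << T j >> *~ D j.
have : (<< V >> - y) \in @G0_rel F M.
  (* Equality in the quotient is membership of the difference in the relations, on which [frank]
     vanishes. *)
  rewrite Quotient.idealrBE; apply/eqP; rewrite [LHS]eV /y.
  rewrite raddf_sum; apply: eq_bigr => j _; by rewrite raddfMz.
move=> /asboolP/frank_rel/eqP; rewrite frankB subr_eq0 frankU => /eqP->.
rewrite raddf_sum; apply: eq_bigr => j _.
by rewrite raddfMz /= frankU -mulrzr intz.
Qed.

End GrothendieckRank.

(** * Idempotents of the monoid algebra *)

Section BasicIdempotents.
Variables (F : fieldType) (M : finMonoidType).
Implicit Types U V W P S : lmod F M.
Local Notation reg := (regular_lmod F M).

(** [E] is the projection of RM onto a direct summand isomorphic to [P], with [U] the inclusion and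
    [V] the retraction. *)
Definition idem_of P (E : 'M[F]_#|M|) : Prop :=
  exists (U : 'M_(#|M|, ldim P)) (V : 'M_(ldim P, #|M|)),
  [/\ E = U *m V, V *m U = 1%:M, @intertwiner F M P reg U
    & @intertwiner F M reg P V].

Lemma idem_of_endo P E : idem_of P E -> endo E.
Proof. by move=> [U [V [-> _ hU hV]]]; apply: (intertwinerM hU hV). Qed.

Lemma idem_of_idem P E : idem_of P E -> E *m E = E.
Proof. by move=> [U [V [-> VU _ _]]]; rewrite mulmxA -(mulmxA U) VU mulmx1. Qed.

Lemma idem_of_exists n (P S : 'I_n -> lmod F M) :
  represents_PIMs P -> (forall i, is_top (S i) (P i)) ->
  exists e : 'I_n -> 'M[F]_#|M|, forall i, idem_of (P i) (e i).
Proof.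
move=> [hP _ _] hS; have /choice[e he] : forall i, exists E, idem_of (P i) E.
  move=> i; have [pP iP] := hP i.
  have [U [V [VU hU hV]]] := PIM_idem pP iP (hS i).
  by exists (U *m V), U, V.
by exists e.
Qed.

(** The rank of [E] is additive along a composition series and is 1 or 0 on a factor according as
    the factor is isomorphic to [S]. Every composition series thus gives the same count. *)
Lemma multiplicity_ev P S E V : splitting_field F M ->
  projective P -> indecomposable P -> is_top S P -> idem_of P E ->
  multiplicity S V = \rank (ev V E).
Proof.
move=> sp pP iP tS hE.
have count_rank W s : composition_factors W s ->
    count (fun W' => `[< isomorphic W' S >]) s = \rank (ev W E).
  elim=> [{}W W0|U {}W W' {}s ses sW' _ IH] /=.
    have : (\rank (ev W E) <= 0)%N by rewrite -[X in (_ <= X)%N]W0 rank_leq_row.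
    by case: (\rank _).
  rewrite IH (rank_ev_ses (idem_of_endo hE) (idem_of_idem hE) ses) addnC.
  by have [A [B [-> VU hU hV]]] := hE; rewrite (rank_ev_PIM (W := W') sp pP iP tS).
rewrite /multiplicity; set X := (X in xget _ X).
(* A composition series exists, so the default value 0 of [xget] does not intervene. *)
have [|s hs ->] := @xgetPex _ 0%N X; last exact: count_rank.
have [s hs] := composition_factors_exist V.
by exists (count (fun W' => `[< isomorphic W' S >]) s), s.
Qed.

Lemma rank_ev_top n (P S : 'I_n -> lmod F M) (e : 'I_n -> 'M[F]_#|M|) :
  splitting_field F M ->
  represents_PIMs P -> (forall i, is_top (S i) (P i)) ->
  (forall i, idem_of (P i) (e i)) ->
  forall i l, \rank (ev (S l) (e i)) = (i == l).
Proof.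
move=> sp [hP injP _] hS he i l.
have [pP iP] := hP i; have [pP' iP'] := hP l.
have [U [V [-> VU hU hV]]] := he i.
have [sS _] := PIM_top pP' iP' (hS l).
rewrite (rank_ev_PIM sp pP iP (hS i)) //; congr nat_of_bool.
apply/asboolP/eqP => [iso|->]; last first.
  apply/isomorphicP; exists 1%:M, 1%:M; rewrite mulmx1; split=> //.
  exact: intertwiner_id.
apply: injP; apply: isomorphic_top_PIM (isomorphic_sym iso) => //.
Qed.

Lemma idem_rank_lt m (p : 'M[F]_m) : p *m p = p -> p != 1%:M -> (\rank p < m)%N.
Proof.
move=> pp; rewrite ltn_neqAle rank_leq_row andbT; apply: contra => fp.
have up : p \in unitmx by rewrite -row_free_unit.
by rewrite -[p]mulmx1 -(mulmxV up) mulmxA pp.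
Qed.

(** A map from RM is lifted by lifting the image of 1, here to [v]; restricting the lift along [B]
    serves the summand [P]. *)
Lemma summand_projective P (B : 'M[F]_(#|M|, ldim P)) B' :
  B' *m B = 1%:M -> @intertwiner F M P reg B -> @intertwiner F M reg P B' ->
  projective P.
Proof.
move=> BB hB hB' V W g f [hg img] hf.
have {}hg : intertwiner (hom_mx g) by apply/is_homP.
have {}hf : intertwiner (hom_mx f) by apply/is_homP.
have [g' gg'] := limgf_mx img.
pose v := g' *m (hom_mx f *m B' *m mbasis F 1%g).
have hv : @intertwiner F M reg V (orbit_mx v) by apply: orbit_mxP.
exists (mx_hom (orbit_mx v *m B)).
  by apply/is_homP; rewrite hom_mxK; apply: (intertwinerM hv hB).
apply/lfunP=> u; rewrite comp_lfunE mx_homE !hom_mxE -mulmxA orbit_mxE mulmxA.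
have hfB : @intertwiner F M reg W (hom_mx f *m B') by apply: intertwinerM.
rewrite (intertwiner_mact _ hg) -mulmxA (mulmxA _ g') gg' mul1mx.
by rewrite -(regular_hom _ hfB) mulmxA -(mulmxA _ B') BB mulmx1.
Qed.

Lemma idem_module E : endo E -> E *m E = E ->
  exists P, idem_of P E /\ ldim P = \rank E.
Proof.
move=> hE EE; have [r [B [B' [BB B'B rE]]]] := idem_split EE.
have EB : E *m B = B by rewrite -BB -mulmxA B'B mulmx1.
have BE : B' *m E = B' by rewrite -BB mulmxA B'B mul1mx.
have LB m : E *m lreg F m *m B = lreg F m *m B by rewrite hE -mulmxA EB.
have cut x y : B' *m lreg F x *m B *m (B' *m lreg F y *m B) =
    B' *m (lreg F x *m lreg F y) *m B.
  rewrite -!mulmxA (mulmxA B B') BB !mulmxA -(mulmxA _ (lreg F x) E) -hE.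
  by rewrite mulmxA BE.
exists (cut_lmod (V := reg) B'B cut); split=> //; exists B, B'; split=> // m.
  by rewrite /= mulmxA (mulmxA B) BB LB.
change (B' *m lreg F m = B' *m lreg F m *m B *m B').
by rewrite -!mulmxA BB -hE mulmxA BE.
Qed.

(* Hattori-Stallings: a trace functional on [endo] only sees the class of the
   projective module cut out by an idempotent. *)
Lemma idem_trace n (P S : 'I_n -> lmod F M) (e : 'I_n -> 'M[F]_#|M|)
    (t : 'M[F]_#|M| -> F) :
  splitting_field F M ->
  represents_PIMs P -> (forall i, is_top (S i) (P i)) ->
  (forall i, idem_of (P i) (e i)) ->
  (forall A B, t (A + B) = t A + t B) ->
  (forall A B, endo A -> endo B -> t (A *m B) = t (B *m A)) ->
  forall E, endo E -> E *m E = E ->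
  t E = \sum_i (\rank (ev (S i) E))%:R * t (e i).
Proof.
move=> sp hP hS he tD tC E hE EE.
(* In trace form both sides are visibly additive in [E], which allows induction on the rank by
   splitting [E]. *)
under eq_bigr => i _ do rewrite -(idem_rank_mxtrace (ev_idem hE EE (S i))).
have [r leEr] := ubnP (\rank E); elim: r E leEr hE EE => // r IH E leEr hE EE.
have t0 : t 0 = 0 by apply: (addrI (t 0)); rewrite -tD !addr0.
have [E0|E0] := posnP (\rank E).
  move/eqP: E0; rewrite mxrank_eq0 => /eqP->; rewrite t0 big1 // => i _.
  by rewrite ev0 mxtrace0 mul0r.
have [W [[U [V [eE VU hU hV]]] dW]] := idem_module hE EE.
have [iW|nW] := EM (indecomposable W).
  have [_ _ /(_ W (summand_projective VU hU hV) iW) [i]] := hP.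
  move=> /isomorphicP[phi [phi' [hphi phiK phiK']]].
  have [Ui [Vi [ei VUi hUi hVi]]] := he i.
  have hphi' := intertwiner_inv hphi phiK phiK'.
  (* The isomorphism between [W] and [P i] exhibits [e i] as [u *m v] and [E] as [v *m u], which no
     trace functional distinguishes. *)
  pose u : 'M_#|M| := Ui *m phi *m V; pose v : 'M_#|M| := U *m phi' *m Vi.
  have hu : endo u by apply: (intertwinerM (intertwinerM hUi hphi) hV).
  have hv : endo v by apply: (intertwinerM (intertwinerM hU hphi') hVi).
  have uv : u *m v = e i.
    by rewrite /u /v ei !mulmxA -(mulmxA _ V) VU mulmx1 -(mulmxA Ui) phiK' mulmx1.
  have vu : v *m u = E.
    by rewrite /u /v eE !mulmxA -(mulmxA _ Vi) VUi mulmx1 -(mulmxA U) phiK mulmx1.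
  rewrite (bigD1 i) //= big1 ?addr0 => [|l ne].
    rewrite -{2}vu evM // mxtrace_mulC -evM // uv.
    rewrite (idem_rank_mxtrace (ev_idem (idem_of_endo (he i)) (idem_of_idem (he i)) _)).
    by rewrite (rank_ev_top sp hP hS he) eqxx mul1r -vu tC // uv.
  rewrite -vu evM // mxtrace_mulC -evM // uv.
  rewrite (idem_rank_mxtrace (ev_idem (idem_of_endo (he i)) (idem_of_idem (he i)) _)).
  by rewrite (rank_ev_top sp hP hS he) eq_sym (negPf ne) mul0r.
(* A non-trivial idempotent endomorphism of [W] splits [E] into two idempotents of smaller rank. *)
have [|p [pp hp p0 p1]] := not_indec_idem _ nW; first by rewrite dW.
have split_idem q : q *m q = q -> @intertwiner F M W W q -> q != 1%:M ->
    [/\ endo (U *m q *m V), U *m q *m V *m (U *m q *m V) = U *m q *m V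
      & (\rank (U *m q *m V) < r)%N].
  move=> qq hq q1; split.
  - exact: (intertwinerM (intertwinerM hU hq) hV).
  - by rewrite !mulmxA -(mulmxA _ V) VU mulmx1 -(mulmxA U) qq.
  rewrite (leq_ltn_trans (mxrankM_maxl _ _)) // (leq_ltn_trans (mxrankM_maxr _ _)) //.
  by rewrite (leq_trans (idem_rank_lt qq q1)) // dW -ltnS.
have [h1 i1 r1] := split_idem p pp hp p1.
have [|||h2 i2 r2] := split_idem (1%:M - p).
- by rewrite mulmxBr mulmx1 mulmxBl mul1mx pp subrr subr0.
- by move=> m; rewrite mulmxBl mulmxBr mul1mx mulmx1 hp.
- by apply: contra p0 => /eqP p1E; rewrite -[p](subKr 1%:M) p1E subrr.
have {1}-> : E = U *m p *m V + U *m (1%:M - p) *m V.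
  by rewrite -mulmxDl -mulmxDr addrC subrK mulmx1.
have eEV l : ev (S l) E = ev (S l) (U *m p *m V) + ev (S l) (U *m (1%:M - p) *m V).
  by rewrite -evD -mulmxDl -mulmxDr [p + _]addrC subrK mulmx1 eE.
rewrite tD IH // IH // -big_split; apply: eq_bigr => l _ /=.
by rewrite -mulrDl -mxtraceD eEV.
Qed.

End BasicIdempotents.

(** * Lifting from the residue field *)

(* Newton iteration for [z^2 - z]; the identity is inherited from the
   polynomial in one variable through [horner_mx]. *)
Lemma newton_idem (R : comNzRingType) n (z : 'M[R]_n) :
  let d := z *m z - z in let z' := z + d *m (1%:M - z *+ 2) in
  exists x, z' *m z' - z' = d *m d *m x.
Proof.
case: n z => [|n] z d z'; first by exists 0; rewrite !thinmx0.
pose D : {poly R} := 'X * 'X - 'X; pose Z := 'X + D * (1 - 'X *+ 2).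
have hD : horner_mx z D = d by rewrite rmorphB rmorphM /= horner_mx_X.
have hZ : horner_mx z Z = z'.
  by rewrite rmorphD rmorphM /= hD rmorphB rmorph1 rmorphMn /= horner_mx_X.
exists (horner_mx z (D *+ 4 - 3%:R)).
rewrite -hD -hZ; change mulmx with (@GRing.mul 'M[R]_n.+1).
rewrite -!rmorphM -rmorphB /=; congr (horner_mx z _).
by rewrite /Z /D; ring.
Qed.

Section ModularSystem.
Variables (p : nat) (F : fieldType) (O : idomainType) (k : fieldType).
Variables (sys : p_modular_system p F O k).
Local Notation incl := (pms_incl sys).
Local Notation res := (pms_res sys).

Lemma res_unit a : res a != 0 -> a \is a GRing.unit.
Proof. by apply: contraR => na; apply/eqP/pms_res_ker. Qed.

Lemma res_unitmx n (X : 'M[O]_n) : map_mx res X \in unitmx -> X \in unitmx.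
Proof. by rewrite !unitmxE det_map_mx unitfE => /res_unit. Qed.

Lemma lift_mx m n (X : 'M[k]_(m, n)) : exists Y, map_mx res Y = X.
Proof.
have [s hs] := choice (pms_res_surj sys).
by exists (map_mx s X); apply/matrixP=> i j; rewrite !mxE.
Qed.

Lemma map_incl_inj m n : injective (map_mx incl : 'M_(m, n) -> _).
Proof.
move=> A B /matrixP e; apply/matrixP=> i j.
by have := e i j; rewrite !mxE => /pms_incl_inj.
Qed.

Lemma rank_split (K : fieldType) n r (B : 'M[K]_(n, r)) B' :
  B' *m B = 1%:M -> \rank (B *m B') = r.
Proof.
move=> BB; rewrite mxrankMfree; last by apply/row_freeP; exists B.
rewrite -mxrank_tr; apply/eqP; rewrite -/(row_free _); apply/row_freeP.
by exists B'^T; rewrite -trmx_mul BB trmx1.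
Qed.

(** A splitting of the reduction lifts to [U] and [W] over O with [W *m U] = 1, the needed inverse
    existing because its reduction does. Then [Z - U *m W] is an idempotent with reduction 0; its
    complement is invertible, so it is 0. Thus [Z] itself splits over O with the same [r]. *)
Lemma idem_rank_res n (Z : 'M[O]_n) : Z *m Z = Z ->
  \rank (map_mx incl Z) = \rank (map_mx res Z).
Proof.
move=> ZZ; have EE : map_mx res Z *m map_mx res Z = map_mx res Z.
  by rewrite -map_mxM ZZ.
have [r [u [v [uv vu <-]]]] := idem_split EE.
have [u' hu] := lift_mx u; have [v' hv] := lift_mx v.
pose U := Z *m u'; pose V := v' *m Z.
have unitVU : V *m U \in unitmx.
  apply: res_unitmx; rewrite !map_mxM hu hv -uv !mulmxA.
  by rewrite !(vu, mul1mx) unitmx1.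
pose W := invmx (V *m U) *m V.
have WU : W *m U = 1%:M by rewrite -mulmxA mulVmx.
have ZU : Z *m U = U by rewrite mulmxA ZZ.
have WZ : W *m Z = W by rewrite /W /V -!mulmxA ZZ.
have resU : map_mx res U = u by rewrite map_mxM hu -uv -mulmxA vu mulmx1.
have resV : map_mx res V = v by rewrite map_mxM hv -uv mulmxA vu mul1mx.
have resW : map_mx res W = v.
  have e : map_mx res (V *m U) = 1%:M by rewrite map_mxM resU resV vu.
  by rewrite -resV -(mulKVmx unitVU V) [RHS]map_mxM e mul1mx.
clearbody W; clearbody U.
have Y0 : Z - U *m W = 0.
  have Y1 : 1%:M - (Z - U *m W) \in unitmx.
    apply: res_unitmx; rewrite !map_mxB map_mx1 map_mxM resU resW uv.
    by rewrite subrr subr0 unitmx1.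
  have YY : (Z - U *m W) *m (1%:M - (Z - U *m W)) = 0.
    rewrite mulmxBr mulmx1 mulmxBl !mulmxBr ZZ !mulmxA ZU.
    by rewrite -(mulmxA U W Z) WZ -(mulmxA U W U) WU mulmx1 subrr subr0 subrr.
  by rewrite -[LHS]mulmx1 -(mulmxV Y1) mulmxA YY mul0mx.
move/eqP: Y0; rewrite subr_eq0 => /eqP->.
by rewrite map_mxM rank_split // -map_mxM WU map_mx1.
Qed.

Lemma uniformizer : exists pi : O,
  [/\ res pi = 0, (forall x, res x = 0 -> exists b, x = b * pi)
    & forall n x, ideal_pow (@nonunits O) n x <-> exists b, x = pi ^+ n * b].
Proof.
have [pid [i0 iD iM] _] := pms_dvr sys.
have [|pi hpi] := pid (@nonunits O); first by split.
exists pi; have pin : nonunits pi by apply/hpi; exists 1; rewrite mul1r.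
split=> [|x|]; first exact/pms_res_ker.
  by move/pms_res_ker/hpi.
elim=> [|n IH] x /=; first by split=> // _; exists x; rewrite expr0 mul1r.
split=> [[s hs ->]|[b ->]]; last first.
  exists [:: (pi, pi ^+ n * b)]; last by rewrite big_seq1 /= exprS mulrA.
  move=> ab; rewrite inE => /eqP-> /=; split=> //.
  by apply/IH; exists b.
rewrite big_seq.
elim/big_ind: _ => [|_ _ [b ->] [c ->]|ab /hs [/hpi [b ->] /IH [c ->]]].
- by exists 0; rewrite mulr0.
- by exists (b + c); rewrite mulrDr.
by exists (b * c); rewrite exprS; ring.
Qed.

Lemma idem_limit n (pi : O) (Z : nat -> 'M[O]_n) :
  (forall m x, ideal_pow (@nonunits O) m x <-> exists b, x = pi ^+ m * b) ->
  (forall m, exists Y, Z m.+1 - Z m = pi ^+ m *: Y) ->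
  exists L, forall m, exists Y, L - Z m = pi ^+ m *: Y.
Proof.
move=> hpow hZ; have [_ compl] := pms_complete sys.
have lim i j : exists l, forall m, ideal_pow (@nonunits O) m (l - Z m i j).
  apply: compl => m; have [Y /matrixP e] := hZ m.
  by apply/hpow; exists (Y i j); have := e i j; rewrite !mxE.
have /choice[l hl] : forall ij, exists l,
  forall m, ideal_pow (@nonunits O) m (l - Z m ij.1 ij.2) by move=> ij; apply: lim.
exists (\matrix_(i, j) l (i, j)) => m.
have /choice[Y hY] : forall ij, exists b, l ij - Z m ij.1 ij.2 = pi ^+ m * b.
  by move=> ij; apply/hpow.
exists (\matrix_(i, j) Y (i, j)); apply/matrixP=> i j; rewrite !mxE.
exact: (hY (i, j)).
Qed.

Lemma mx_separated n (pi : O) (X : 'M[O]_n) :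
  (forall m x, ideal_pow (@nonunits O) m x <-> exists b, x = pi ^+ m * b) ->
  (forall m, exists Y, X = pi ^+ m *: Y) -> X = 0.
Proof.
move=> hpow hX; apply/matrixP=> i j; rewrite mxE; apply: (pms_complete sys).1 => m.
by apply/hpow; have [Y ->] := hX m; exists (Y i j); rewrite mxE.
Qed.

(** Lifting [E] entry by entry would not give a module endomorphism; instead lift the element E(1)
    and take right multiplication by it. *)
Lemma endo_lift (M : finMonoidType) (E : 'M[k]_#|M|) : endo E ->
  exists2 Z : 'M[O]_#|M|, endo Z & map_mx res Z = E.
Proof.
move=> hE; have [a ha] := lift_mx (E *m mbasis k 1%g).
pose Z : 'M[O]_#|M| := \matrix_(i, j) (lreg O (enum_val j) *m a) i 0.
have ZE x : Z *m mbasis O x = lreg O x *m a.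
  by rewrite -colE; apply/colP=> i; rewrite !mxE enum_rankK.
clearbody Z; exists Z => [m|].
  apply: mulmx_basis => x.
  by rewrite -mulmxA lreg_mbasis ZE -mulmxA ZE lreg_mul mulmxA.
apply: mulmx_basis => x; rewrite -(map_mbasis res) -map_mxM ZE map_mxM ha.
by rewrite map_lreg mulmxA -hE -mulmxA lreg_mbasis mulg1 map_mbasis.
Qed.

Lemma idem_lift (M : finMonoidType) (E : 'M[k]_#|M|) : endo E -> E *m E = E ->
  exists Z : 'M[O]_#|M|, [/\ endo Z, Z *m Z = Z & map_mx res Z = E].
Proof.
move=> hE EE; have [pi [pi0 hpi hpow]] := uniformizer.
have [Z0 hZ0 Z0E] := endo_lift hE.
(* Each Newton step is a polynomial in [z], so the iterates stay in [endo]; the correction vanishes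
   in the residue field. *)
pose f (z : 'M[O]_#|M|) := z + (z *m z - z) *m (1%:M - z *+ 2).
pose Z m := iter m f Z0.
have hZ m : endo (Z m).
  elim: m => // m IH; rewrite /= /f mulr2n.
  apply: (endoD IH); apply: endoM; first by apply: (endoB (endoM IH IH) IH).
  by apply: (endoB (@endo1 _ _) (endoD IH IH)).
have ZE m : map_mx res (Z m) = E.
  elim: m => // m IH; rewrite /= /f map_mxD IH map_mxM map_mxB map_mxM IH EE subrr.
  by rewrite mul0mx addr0.
have ZZ m : exists Y, Z m *m Z m - Z m = pi ^+ m.+1 *: Y.
  elim: m => [|m [Y hY]].
    have /choice[Y hY] : forall ij, exists b, (Z0 *m Z0 - Z0) ij.1 ij.2 = b * pi.
      move=> ij; apply: hpi.
      have /matrixP/(_ ij.1 ij.2) : map_mx res (Z0 *m Z0 - Z0) = 0.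
        by rewrite map_mxB map_mxM Z0E EE subrr.
      by rewrite [LHS]mxE [RHS]mxE.
    exists (\matrix_(i, j) Y (i, j)); apply/matrixP=> i j.
    by have := hY (i, j); rewrite /= => ->; rewrite !mxE expr1 mulrC.
  have [X] := newton_idem (Z m); rewrite -/(f _) hY => e.
  (* Squaring the error doubles the exponent to 2m + 2, of which only m + 2 is claimed. *)
  exists (pi ^+ m *: (Y *m Y *m X)); rewrite [Z m.+1]/= -/(Z m) e.
  by rewrite -!scalemxAl -scalemxAr scalerA -!scalemxAl scalerA -!exprD [in RHS]addSnnS.
have [m|L hL] := idem_limit (Z := Z) hpow.
  have [Y hY] := ZZ m; exists (pi *: (Y *m (1%:M - Z m *+ 2))).
  by rewrite [Z m.+1]/= /f -/(Z m) addrAC subrr add0r hY scalerA -exprSr scalemxAl.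
exists L; split.
- move=> x; apply/eqP; rewrite -subr_eq0; apply/eqP.
  apply: (mx_separated hpow) => m; have [Y hY] := hL m.
  exists (Y *m lreg O x - lreg O x *m Y).
  rewrite scalerBr scalemxAl scalemxAr -hY mulmxBl mulmxBr hZ opprB addrA.
  by rewrite subrK.
- apply/eqP; rewrite -subr_eq0; apply/eqP.
  apply: (mx_separated hpow) => m; have [Y hY] := hL m; have [Y' hY'] := ZZ m.
  have -> : L *m L - L = L *m (L - Z m) + (L - Z m) *m Z m - (L - Z m)
            + (Z m *m Z m - Z m).
    rewrite mulmxBr mulmxBl opprB [_ + (_ - Z m *m Z m)]addrA subrK.
    rewrite addrAC [_ + (Z m *m Z m - _)]addrA subrK.
    by rewrite addrA subrK.
  exists (L *m Y + Y *m Z m - Y + pi *: Y').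
  rewrite hY hY' !scalerDr scalerN scalerA -exprSr.
  by rewrite -scalemxAr -scalemxAl.
(* Index 1 is the first at which the congruence with the limit is modulo [pi]. *)
have [Y] := hL 1%N; move/(congr1 (map_mx res)).
rewrite map_mxB ZE map_mxZ expr1 pi0 scale0r => /eqP.
by rewrite subr_eq0 => /eqP.
Qed.

End ModularSystem.

(** * Lattices *)

Section IntegralForm.
Variables (p : nat) (F : fieldType) (O : idomainType) (k : fieldType).
Variables (sys : p_modular_system p F O k) (M : finMonoidType).
Local Notation incl := (pms_incl sys).

Lemma incl_neq0 a : a != 0 -> incl a != 0.
Proof.
apply: contra => /eqP a0; apply/eqP/(@pms_incl_inj _ _ _ _ sys).
by rewrite a0 rmorph0.
Qed.

(** O is a valuation ring. Dividing numerator and denominator by a generator [c] of the ideal they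
    span makes them coprime, and in a local ring one of two coprime elements is a unit. *)
Lemma incl_total x : x != 0 ->
  (exists a, x = incl a) \/ (exists a, x^-1 = incl a).
Proof.
have [pid [nu0 nuD nuM] _] := pms_dvr sys.
have [a [b [b0 ->]]] := pms_frac sys x => x0.
pose I y := exists s t, y = s * a + t * b.
have [|c hc] := pid I.
  split=> [|_ _ [s [t ->]] [s' [t' ->]]|u _ [s [t ->]]].
  - by exists 0, 0; rewrite !mul0r addr0.
  - by exists (s + s'), (t + t'); ring.
  by exists (u * s), (u * t); ring.
have [a' ea] : exists a', a = a' * c by apply/hc; exists 1, 0; ring.
have [b' eb] : exists b', b = b' * c by apply/hc; exists 0, 1; ring.
have [s [t ec]] : I c by apply/hc; exists 1; rewrite mul1r.
have c0 : c != 0 by apply: contra b0 => /eqP c0; rewrite eb c0 mulr0.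
have e1 : s * a' + t * b' = 1.
  by apply: (mulIf c0); rewrite mul1r [RHS]ec ea eb; ring.
have cF := incl_neq0 c0.
have eF : incl a / incl b = incl a' / incl b'.
  by rewrite ea eb !rmorphM invfM mulrACA divff // mulr1.
have [ub|nb] := boolP (b' \is a GRing.unit).
  by left; exists (a' / b'); rewrite eF rmorphM rmorphV.
have [ua|na] := boolP (a' \is a GRing.unit).
  by right; exists (b' / a'); rewrite eF rmorphM rmorphV // invfM invrK mulrC.
have : nonunits (s * a' + t * b') by apply: nuD; apply: nuM.
by rewrite e1 /nonunits unitr1.
Qed.

Lemma min_valuation (I : finType) (v : I -> F) i0 : v i0 != 0 ->
  exists i, v i != 0 /\ forall j, exists a, v j / v i = incl a.
Proof.
move=> vi0; suff [i [vi hi]] : exists i, v i != 0 /\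
    forall j, j \in i0 :: enum I -> exists a, v j / v i = incl a.
  by exists i; split=> // j; apply: hi; rewrite inE mem_enum orbT.
elim: (enum I) => [|l s [i [vi hi]]].
  exists i0; split=> // j; rewrite inE => /eqP->; exists 1.
  by rewrite divff // rmorph1.
have [vl|vl] := eqVneq (v l) 0.
  exists i; split=> // j; rewrite !inE orbCA => /orP[/eqP->|js].
    by exists 0; rewrite vl mul0r rmorph0.
  by apply: hi; rewrite inE.
have [[a ea]|[a ea]] := incl_total (mulf_neq0 vl (invr_neq0 vi)).
  exists i; split=> // j; rewrite !inE orbCA => /orP[/eqP->|js]; first by exists a.
  by apply: hi; rewrite inE.
exists l; split=> // j; rewrite !inE orbCA => /orP[/eqP->|js].
  by exists 1; rewrite divff // rmorph1.
have [|b eb] := hi j; first by rewrite inE.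
exists (b * a); rewrite rmorphM -eb -ea; field.
by rewrite vi vl.
Qed.

(* Among all the n-tuples of translates of basis vectors take one whose
   determinant has minimal valuation: by Cramer's rule it is an O-basis of the
   lattice spanned by all the translates. *)
Lemma integral_form (V : lmod F M) :
  exists L : lmod O M, isomorphic (base_change incl L) V.
Proof.
pose n := ldim V.
pose H (f : {ffun 'I_n -> M * 'I_n}) : 'M[F]_n :=
  \matrix_(i, j) lact V (f j).1 i (f j).2.
have H1 : \det (H [ffun j => (1%g, j)]) != 0.
  have -> : H [ffun j => (1%g, j)] = 1%:M.
    by apply/matrixP=> i j; rewrite !mxE ffunE /= lact1 !mxE.
  by rewrite det1 oner_eq0.
have [f [Hf0 Hf]] := min_valuation (v := fun f => \det (H f)) H1.
have uH : H f \in unitmx by rewrite unitmxE unitfE.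
have cramer x c i : exists a,
    (invmx (H f) *m (lact V x *m delta_mx c 0 : 'cV_n)) i 0 = incl a.
  pose f' := [ffun j => if j == i then (x, c) else f j].
  have [a ea] := Hf f'; exists a; rewrite -ea /invmx uH -scalemxAl mxE mulrC.
  (* The cofactors along column [i] ignore the replaced column, so they are those of [H f]. *)
  congr (_ / _); rewrite (expand_det_col _ i) mxE; apply: eq_bigr => l _.
  rewrite -colE !mxE ffunE eqxx mulrC; congr (_ * _).
  rewrite /cofactor; congr (_ * \det _); apply/matrixP=> u v; rewrite !mxE.
  by rewrite ffunE eq_sym (negPf (neq_lift _ _)).
have /choice[L hL] : forall m, exists Y : 'M[O]_n,
    map_mx incl Y = invmx (H f) *m lact V m *m H f.
  move=> m; have /choice[Y hY] : forall ij, exists a,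
      (invmx (H f) *m lact V m *m H f) ij.1 ij.2 = incl a.
    (* Acting by [m] on a chosen translate gives another translate, which [cramer] covers. *)
    move=> [i j] /=; have [a ea] := cramer (m * (f j).1)%g (f j).2 i.
    have cH : col j (H f) = lact V (f j).1 *m delta_mx (f j).2 0.
      by rewrite -colE; apply/colP=> u; rewrite !mxE.
    exists a; rewrite -ea lactM -!mulmxA -cH.
    transitivity (col j (invmx (H f) *m (lact V m *m H f)) i 0).
      by rewrite [RHS]mxE.
    by rewrite !colE !mulmxA.
  exists (\matrix_(i, j) Y (i, j)); apply/matrixP=> i j.
  by rewrite mxE [X in incl X]mxE -hY.
have L1 : L 1%g = 1%:M.
  by apply: (@map_incl_inj _ _ _ _ sys); rewrite hL lact1 mulmx1 mulVmx // map_mx1.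
have LM x y : L (x * y)%g = L x *m L y.
  apply: (@map_incl_inj _ _ _ _ sys); rewrite map_mxM !hL lactM !mulmxA.
  by rewrite -(mulmxA _ (H f) (invmx _)) mulmxV // mulmx1.
exists (LMod L1 LM); apply/isomorphicP; exists (H f), (invmx (H f)).
rewrite mulVmx // mulmxV //; split=> // m /=.
by rewrite /= hL !mulmxA mulmxV // mul1mx.
Qed.

End IntegralForm.

(** * Cartan matrices and class functions *)

Section CartanEntries.
Variables (F : fieldType) (M : finMonoidType).
Implicit Types V W P S : lmod F M.
Local Notation reg := (regular_lmod F M).

Lemma rank_sandwich m n q r (U : 'M[F]_(m, n)) U' (X : 'M_(n, q))
    (V : 'M_(q, r)) (V' : 'M_(r, q)) :
  U' *m U = 1%:M -> V *m V' = 1%:M -> \rank (U *m X *m V) = \rank X.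
Proof.
move=> UU VV; apply/eqP; rewrite eqn_leq; apply/andP; split.
  exact: leq_trans (mxrankM_maxl _ _) (mxrankM_maxr _ _).
have {1}-> : X = U' *m (U *m X *m V) *m V'.
  by rewrite !mulmxA UU mul1mx -mulmxA VV mulmx1.
exact: leq_trans (mxrankM_maxl _ _) (mxrankM_maxr _ _).
Qed.

Lemma rank_mact_iso V W a : isomorphic V W -> \rank (mact V a) = \rank (mact W a).
Proof.
move=> /isomorphicP[B [B' [hB B'B BB']]].
rewrite -(rank_sandwich (mact W a) BB' BB'); congr (\rank _).
by rewrite -mulmxA -(intertwiner_mact a hB) mulmxA B'B mul1mx.
Qed.

Lemma mact_summand P E a : idem_of P E ->
  \rank (mact P a) = \rank (mact reg a *m E) /\
  \tr (mact P a) = \tr (mact reg a *m E).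
Proof.
move=> [U [V [-> VU hU hV]]].
have aU : mact reg a *m U = U *m mact P a by rewrite -(intertwiner_mact a hU).
rewrite mulmxA aU (rank_sandwich _ VU VU); split=> //.
by rewrite mxtrace_mulC mulmxA VU mul1mx.
Qed.

(** A complement in RM of the image of a submodule [X] gives a projection whose compression [H] to
    [P] is an idempotent endomorphism with image [X]; indecomposability makes it 0 or 1. *)
Lemma semisimple_PIM P E : semisimple_algebra F M -> indecomposable P ->
  idem_of P E -> simple_lmod P.
Proof.
move=> ss iP [U [V [_ VU hU hV]]]; split=> [|X hX]; first exact: iP.1.
have [Y hY [XY XY0]] := ss _ (submod_img hU hX).
have [p [hp pinX pX _]] := complement_idem (submod_img hU hX) hY XY XY0.
pose H : 'M_(ldim P) := V *m p *m U.
have HX v : H *m v \in X.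
  have /memv_imgP[x Xx] := pinX (U *m v); rewrite mx_homE => e.
  by rewrite /H -!mulmxA e mulmxA VU mul1mx.
have HXid v : v \in X -> H *m v = v.
  move=> Xv; rewrite /H -!mulmxA pX ?mulmxA ?VU ?mul1mx //.
  by rewrite -mx_homE memv_img.
have HH : H *m H = H by apply: eq_mulmx_col => v; rewrite -mulmxA HXid.
have hH : @intertwiner F M P P H by apply: (intertwinerM (intertwinerM hV hp) hU).
have [H0|H1] := indec_idem iP HH hH; [left|right].
  apply/eqP; rewrite -subv0; apply/subvP=> v /HXid <-.
  by rewrite H0 mul0mx mem0v.
by apply/vspaceP=> v; rewrite memvf -[v]mul1mx -H1 HX.
Qed.

Lemma semisimple_cartan n (P S : 'I_n -> lmod F M) : splitting_field F M ->
  represents_PIMs P -> (forall i, is_top (S i) (P i)) ->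
  semisimple_algebra F M -> cartan P S = 1%:M.
Proof.
move=> sp hP hS ss; have [e he] := idem_of_exists hP hS.
apply/matrixP=> i l; rewrite !mxE.
have [pPI _ _] := hP; have [pP iP] := pPI i; have [pP' iP'] := pPI l.
rewrite (multiplicity_ev _ sp pP iP (hS i) (he i)).
have [sS [g hg g0]] := PIM_top pP' iP' (hS l).
have [g' [g'g gg']] := schur (semisimple_PIM ss iP' (he l)) sS hg g0.
have iso : isomorphic (P l) (S l) by apply/isomorphicP; exists g, g'.
by rewrite /ev (rank_mact_iso _ iso) (rank_ev_top sp hP hS he); case: eqP.
Qed.

End CartanEntries.

(** * Class functions and the quotient of RM by commutators *)

Section ClassFunctions.
Variable M : finMonoidType.

(* The equivalence generated by [cyclic_rel] has one class per basis element of
   RM / [RM, RM], over any ring R. *)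
Definition cyclic_rel : rel M :=
  fun x y => [exists a, exists b, (x == (a * b)%g) && (y == (b * a)%g)].

Definition cyclic_root (x : M) : M := fingraph.root cyclic_rel x.

Lemma cyclic_sym : connect_sym cyclic_rel.
Proof.
apply: sym_connect_sym => x y; apply/existsP/existsP=> -[a /existsP[b e]];
  by exists b; apply/existsP; exists a; rewrite andbC.
Qed.

Lemma cyclic_rootC x y : cyclic_root (x * y)%g = cyclic_root (y * x)%g.
Proof.
apply/(fingraph.rootP cyclic_sym)/connect1.
by apply/existsP; exists x; apply/existsP; exists y; rewrite !eqxx.
Qed.

Lemma class_fun_root T (f : M -> T) : (forall x y, f (x * y)%g = f (y * x)%g) ->
  forall x, f x = f (cyclic_root x).
Proof.
move=> fC x; have /connectP[s] := connect_root cyclic_rel x.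
rewrite -/(cyclic_root x) => + ->.
elim: s x => //= y s IH x /andP[/existsP[a /existsP[b /andP[/eqP-> /eqP-> ]]]].
by rewrite fC; apply: IH.
Qed.

Lemma sum_class_fun (R : pzRingType) (a f : M -> R) :
  (forall x y, f (x * y)%g = f (y * x)%g) ->
  (forall z, \sum_(m | cyclic_root m == z) a m = 0) ->
  \sum_m a m * f m = 0.
Proof.
move=> fC a0; rewrite (partition_big cyclic_root xpredT) //= big1 // => z _.
under eq_bigr => m /eqP mz do rewrite (class_fun_root fC) mz.
by rewrite -mulr_suml a0 mul0r.
Qed.

(** Expanded in the coefficients of A(1) and B(1), the two values are the same double sum up to
    exchanging the arguments of [f]. *)
Lemma class_fun_trace (R : comNzRingType) (f : M -> R) (A B : 'M[R]_#|M|) :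
  (forall x y, f (x * y)%g = f (y * x)%g) -> endo A -> endo B ->
  let t E := \sum_m (E *m mbasis R 1%g) (enum_rank m) 0 * f m in
  t (A *m B) = t (B *m A).
Proof.
move=> fC hA hB.
pose g (v : 'cV[R]_#|M|) := \sum_m v (enum_rank m) 0 * f m.
have gD u v : g (u + v) = g u + g v.
  by rewrite -big_split; apply: eq_bigr => m _; rewrite mxE mulrDl.
have gZ c u : g (c *: u) = c * g u.
  by rewrite [RHS]mulr_sumr; apply: eq_bigr => m _; rewrite mxE mulrA.
have g0 : g 0 = 0 by rewrite /g big1 // => m _; rewrite mxE mul0r.
have gsum (I : finType) (u : I -> 'cV_#|M|) : g (\sum_i u i) = \sum_i g (u i).
  by elim/big_rec2: _ => // i y x _ <-.
have gE (C D : 'M[R]_#|M|) : endo C -> g (C *m D *m mbasis R 1%g) =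
   \sum_n \sum_m (D *m mbasis R 1%g) (enum_rank n) 0 *
     ((C *m mbasis R 1%g) (enum_rank m) 0 * f (n * m)%g).
  move=> hC; rewrite -mulmxA (endo_act _ hC) gsum; apply: eq_bigr => n _.
  rewrite gZ {1}[C *m _]mbasis_decomp mulmx_sumr gsum mulr_sumr.
  apply: eq_bigr => m _; rewrite -scalemxAr gZ lreg_mbasis; congr (_ * (_ * _)).
  rewrite /g (bigD1 (n * m)%g) //= big1 ?addr0 => [|l ne].
    by rewrite mxE !eqxx mul1r.
  by rewrite mxE (inj_eq enum_rank_inj) (negPf ne) mul0r.
move=> t; rewrite [LHS]gE // [RHS]gE // exchange_big.
by apply: eq_bigr => n _; apply: eq_bigr => m _; rewrite fC mulrCA.
Qed.

End ClassFunctions.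

(** * Integer matrices: descent, rank and positivity *)

Section IntegerMatrices.
Import Order.TTheory Num.Theory.

(** Dividing a kernel vector by [p] stays in the kernel, so every power of [p] divides each entry.
    The power with exponent [|x_j|] exceeds [|x_j|], which forces the entry to be 0. *)
Lemma int_kernel_descent p n r (D : 'M[int]_(n, r)) : prime p ->
  (forall x : 'cV_r, D *m x = 0 -> forall j, (p %| x j 0%R)%Z) ->
  forall x : 'cV_r, D *m x = 0 -> x = 0.
Proof.
move=> pp Dp; have p0 : p%:Z != 0 by rewrite -lt0n prime_gt0.
have pow m : forall x : 'cV_r, D *m x = 0 -> forall j, ((p ^ m)%N %| x j 0%R)%Z.
  elim: m => [|m IH] x Dx j; first by rewrite expn0 dvd1z.
  pose y : 'cV_r := \col_i (x i 0%R %/ p)%Z.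
  have xy : x = p%:Z *: y.
    by apply/colP=> i; rewrite !mxE mulrC divzK ?Dp.
  have Dy : D *m y = 0.
    move: Dx; rewrite xy -scalemxAr => /eqP; rewrite scalemx_eq0 (negPf p0).
    by move/eqP.
  by rewrite xy mxE expnS PoszM dvdz_mul // IH.
move=> x Dx; apply/colP=> j; rewrite mxE; apply/eqP; apply: contraT => xj.
have := pow `|x j 0%R|%N x Dx j; rewrite dvdzE /= => /dvdn_leq.
by rewrite lt0n absz_eq0 xj => /(_ isT); rewrite leqNgt ltn_expl ?prime_gt1.
Qed.

Lemma int_kernel_rank n r (D : 'M[int]_(n, r)) :
  (forall x : 'cV_r, D *m x = 0 -> x = 0) ->
  \rank (map_mx intr D : 'M[rat]_(n, r)) = r.
Proof.
move=> kD; apply/eqP; rewrite -mxrank_tr -/(row_free _) -kermx_eq0.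
apply/eqP/row_matrixP=> i; rewrite row0; set v := row i _.
have vD : v *m (map_mx intr D : 'M[rat]_(n, r))^T = 0.
  by apply/sub_kermxP; apply: row_sub.
(* A rational kernel vector becomes integral after multiplication by the product [d] of its
   denominators. *)
pose x : 'cV[int]_r := \col_j (numq (v 0 j) * \prod_(l | l != j) denq (v 0 l)).
pose d : int := \prod_l denq (v 0 l).
have d0 : (d%:~R : rat) != 0.
  by rewrite intr_eq0; apply/prodf_neq0 => l _; rewrite denq_neq0.
have xv : map_mx intr x = d%:~R *: v^T :> 'cV[rat]_r.
  apply/colP=> j; rewrite [RHS]mxE 2!mxE [v^T j 0]mxE /d [in RHS](bigD1 j) //= !intrM.
  by rewrite numqE; ring.
have : x = 0.
  apply: kD; have : map_mx intr (D *m x) = 0 :> 'cV[rat]_n.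
    rewrite map_mxM xv -scalemxAr -[X in X *m _]trmxK -trmx_mul vD trmx0.
    by rewrite scaler0.
  move=> /matrixP e; apply/matrixP=> a b; have := e a b.
  by rewrite mxE [RHS]mxE => /eqP; rewrite intr_eq0 => /eqP->; rewrite mxE.
move=> x0; move/eqP: xv; rewrite x0 map_mx0 eq_sym scalemx_eq0 (negPf d0) /=.
by move=> /eqP/(congr1 trmx); rewrite trmxK trmx0.
Qed.

(** The rank is unchanged from the rationals to [K], so [D] stays injective, and the form is a sum
    of squares of the entries of [D x]. *)
Lemma gram_positive_definite n r (D : 'M[int]_(n, r)) :
  \rank (map_mx intr D : 'M[rat]_(n, r)) = r -> positive_definite (D^T *m D).
Proof.
move=> rD K x x0; rewrite map_mxM -map_trmx.
set A := map_mx intr D : 'M[K]_(n, r).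
have fA : row_free A^T.
  rewrite /row_free mxrank_tr; have -> : A = map_mx ratr (map_mx intr D).
    by apply/matrixP=> i j; rewrite !mxE ratr_int.
  by rewrite mxrank_map rD.
have y0 : A *m x != 0.
  apply: contra x0 => /eqP e; rewrite -[x]trmxK -[0]trmxK; apply/eqP; congr trmx.
  by apply: (row_free_inj fA); rewrite -trmx_mul e !trmx0 mul0mx.
have -> : x^T *m (A^T *m A) *m x = (A *m x)^T *m (A *m x).
  by rewrite trmx_mul !mulmxA.
move: (A *m x) y0 => y y0; rewrite mxE lt0r.
have ge0 i : true -> 0 <= y^T 0 i * y i 0 by rewrite mxE -expr2 sqr_ge0.
rewrite sumr_ge0 // andbT; apply: contra y0; rewrite psumr_eq0 // => /allP e.
apply/eqP/colP=> i; have := e i (mem_index_enum i).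
by rewrite !mxE mulf_eq0 orbb => /eqP.
Qed.

End IntegerMatrices.

(** * Characteristic zero, reduction of ranks, and traces *)

Section Reduction.
Variables (p : nat) (F : fieldType) (O : idomainType) (k : fieldType).
Variables (sys : p_modular_system p F O k) (M : finMonoidType).
Local Notation incl := (pms_incl sys).
Local Notation res := (pms_res sys).

Lemma frac_char0 (z : int) : z%:~R = 0 :> F -> z = 0.
Proof.
have nat0 m : m%:R = 0 :> F -> m = 0%N.
  move=> m0; case: (posnP m) => // mpos.
  have [q qF] : exists q, q \in [pchar F].
    by apply: (natf0_pchar mpos); rewrite m0.
  have := pms_char0 sys q; rewrite !inE => /negbT; rewrite negb_and.
  case/andP: qF => -> /eqP q0 /=.
  by rewrite -(inj_eq (@pms_incl_inj _ _ _ _ sys)) rmorph_nat q0 rmorph0 eqxx.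
case: z => m; rewrite ?NegzE ?mulrNz; first by move/nat0->.
by move/eqP; rewrite oppr_eq0 => /eqP/nat0.
Qed.

Lemma rank_reduction (L : lmod O M) (Z : 'M[O]_#|M|) : endo Z -> Z *m Z = Z ->
  \rank (ev (base_change incl L) (map_mx incl Z)) =
  \rank (ev (base_change res L) (map_mx res Z)).
Proof.
move=> hZ ZZ; rewrite -!map_ev.
exact: (idem_rank_res sys (ev_idem hZ ZZ L)).
Qed.

End Reduction.

(** Makes E |-> tr(X E) a trace functional on [endo] when [X] is a left multiplication of RM. *)
Lemma mxtrace_comm (R : comNzRingType) n (X A B : 'M[R]_n) :
  A *m X = X *m A -> \tr (X *m (A *m B)) = \tr (X *m (B *m A)).
Proof. by move=> XA; rewrite mulmxA -XA -mulmxA mxtrace_mulC mulmxA. Qed.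

Lemma kernel_weighted_sum n r (R : comNzRingType) (x : 'cV[int]_r)
  (D : 'M[int]_(n, r)) (c : 'I_n -> R) : D *m x = 0 ->
  \sum_j (x j 0)%:~R * (\sum_i (D i j)%:~R * c i) = 0.
Proof.
move=> Dx; under eq_bigr => j _ do rewrite mulr_sumr.
rewrite exchange_big big1 //= => i _.
transitivity (((D *m x) i 0)%:~R * c i); last by rewrite Dx mxE mul0r.
rewrite mxE rmorph_sum mulr_suml; apply: eq_bigr => j _ /=.
by rewrite rmorphM mulrA (mulrC (x j 0)%:~R).
Qed.

Lemma mxtrace_mact (R : comNzRingType) (M : finMonoidType) (V : lmod R M) a :
  \tr (mact V a) = \sum_m a (enum_rank m) 0 * \tr (lact V m).
Proof. by rewrite raddf_sum; apply: eq_bigr => m _; rewrite /= mxtraceZ. Qed.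


Theorem theorem3p6 (M : finMonoidType) (p : nat) (F : fieldType)
    (O : idomainType) (k : fieldType) (sys : p_modular_system p F O k)
    (p_prime : prime p)
    (splitF : splitting_field F M) (splitk : splitting_field k M)
    (n r : nat) (P S : 'I_n -> lmod F M) (Q T : 'I_r -> lmod k M)
    (hP : represents_PIMs P) (hS : forall i, is_top (S i) (P i))
    (hQ : represents_PIMs Q) (hT : forall j, is_top (T j) (Q j))
    (d : {additive G0 F M -> G0 k M}) (hd : is_decomposition_map sys d)
    (D : 'M[int]_(n, r))
    (hD : forall i, d (G0_class (S i)) = \sum_(j < r) G0_class (T j) *~ D i j) :
  [/\ cartan Q T = D^T *m cartan P S *m D,
      \rank (map_mx intr D : 'M[rat]_(n, r)) = r
    & semisimple_algebra F M ->
      [/\ cartan Q T = D^T *m D,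
          (cartan Q T)^T = cartan Q T
        & positive_definite (cartan Q T)]].
Proof.
have [e he] := idem_of_exists hP hS; have [e' he'] := idem_of_exists hQ hT.
have [Z hZ] : exists Z : 'I_r -> 'M[O]_#|M|, forall j,
    [/\ endo (Z j), Z j *m Z j = Z j & map_mx (pms_res sys) (Z j) = e' j].
  have /choice[Z hZ] : forall j, exists Z : 'M[O]_#|M|,
    [/\ endo Z, Z *m Z = Z & map_mx (pms_res sys) Z = e' j].
    by move=> j; apply: idem_lift (idem_of_endo (he' j)) (idem_of_idem (he' j)).
  by exists Z.
pose z j := map_mx (pms_incl sys) (Z j).
have hz j : endo (z j) by apply: map_endo; case: (hZ j).
have zz j : z j *m z j = z j by rewrite -map_mxM; case: (hZ j) => _ ->.
(* Pass to a lattice in [S i] and reduce it: the rank over k can be computed from the class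
   d([S_i]), and [e' j] has rank 1 on [T j] and 0 on the other tops. *)
have rank_S i j : (\rank (ev (S i) (z j)))%:Z = D i j.
  have [L iso] := integral_form sys (S i).
  have [hZj ZZj resZj] := hZ j.
  rewrite -(rank_mact_iso _ iso) [LHS](congr1 Posz (rank_reduction sys L hZj ZZj)).
  rewrite resZj (G0_rank (idem_of_endo (he' j)) (idem_of_idem (he' j))
                         (T := T) (D := D i)).
    rewrite (bigD1 j) //= big1 => [|l ne].
      by rewrite (rank_ev_top splitk hQ hT he') eqxx mul1r addr0.
    by rewrite (rank_ev_top splitk hQ hT he') eq_sym (negPf ne) mul0r.
  by rewrite -(hd _ _ iso).
have trace_z (t : 'M[F]_#|M| -> F) j : (forall A B, t (A + B) = t A + t B) ->
    (forall A B, endo A -> endo B -> t (A *m B) = t (B *m A)) ->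
    t (z j) = \sum_i (D i j)%:~R * t (e i).
  move=> tD tC; rewrite (idem_trace splitF hP hS he tD tC (hz j) (zz j)).
  by apply: eq_bigr => i _; rewrite -rank_S.
have multP i i' : multiplicity (S i) (P i') = \rank (ev (P i') (e i)).
  by have [hPI _ _] := hP; apply: multiplicity_ev; rewrite ?he //; case: (hPI i).
have multQ j j' : multiplicity (T j) (Q j') = \rank (ev (Q j') (e' j)).
  by have [hQI _ _] := hQ; apply: multiplicity_ev; rewrite ?he' //; case: (hQI j).
have cartanE : cartan Q T = D^T *m cartan P S *m D.
  apply/matrixP=> j l; apply/eqP; rewrite -subr_eq0; apply/eqP.
  (* Comparing in F lets ranks of idempotents be replaced by traces. *)
  apply: (frac_char0 sys); rewrite rmorphB /=; apply/eqP; rewrite subr_eq0; apply/eqP.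
  rewrite mxE multQ (mact_summand _ (he' l)).1.
  have [hZj ZZj resZj] := hZ j; have [hZl ZZl resZl] := hZ l.
  (* Left multiplication by one idempotent commutes with right multiplication by the other, so [X]
     is idempotent and has the same rank over F and over k. *)
  pose X := ev (regular_lmod O M) (Z j) *m Z l.
  have XX : X *m X = X.
    rewrite /X mulmxA -(mulmxA _ (Z l)) (endo_mact _ hZl) mulmxA.
    by rewrite (ev_idem hZj ZZj) -mulmxA ZZl.
  have -> : mact (regular_lmod k M) (e' j *m mbasis k 1%g) *m e' l =
      map_mx (pms_res sys) X.
    by rewrite -resZj -resZl map_mxM map_mact_regular map_mxM map_mbasis.
  rewrite -(idem_rank_res sys XX) -pmulrn -idem_rank_mxtrace;
    last by rewrite -map_mxM XX.
  rewrite map_mxM map_mact_regular map_mxM map_mbasis -/(z l) -/(z j).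
  (* [trace_z] is applied twice: first to expand [z l] with [z j] fixed, then to expand [z j] by its
     character on each [P i']. The two expansions supply the factors [D] and [D^T]. *)
  rewrite (trace_z (fun E => \tr (mact (regular_lmod F M) (z j *m mbasis F 1%g) *m E))).
  - rewrite mxE rmorph_sum /=; apply: eq_bigr => i' _.
    rewrite mulrC intrM; congr (_ * _).
    rewrite -(mact_summand _ (he i')).2.
    rewrite (trace_z (fun E => \tr (ev (P i') E))).
    + rewrite mxE rmorph_sum /=; apply: eq_bigr => i _.
      rewrite intrM !mxE; congr (_ * _); rewrite multP.
      rewrite -pmulrn idem_rank_mxtrace //.
      exact: ev_idem (idem_of_endo (he i)) (idem_of_idem (he i)) _.
    + by move=> A B; rewrite evD mxtraceD.
    + by move=> A B hA hB; rewrite !evM // mxtrace_mulC.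
  - by move=> A B; rewrite mulmxDr mxtraceD.
  - by move=> A B hA _; exact: mxtrace_comm (endo_mact _ hA).
have ev_e' j V : ev V (e' j) *m ev V (e' j) = ev V (e' j).
  exact: ev_idem (idem_of_endo (he' j)) (idem_of_idem (he' j)) V.
have kerD (x : 'cV_r) : D *m x = 0 -> x = 0.
  apply: int_kernel_descent p_prime _ x => x Dx l.
  rewrite (dvdz_pcharf (pms_charp sys)); apply/eqP.
  (* By [trace_z] every trace functional over F kills [tau], so its class
     coefficients vanish over F, hence over O and, after reduction, over k;
     then the character of [T l] kills the reduction of [tau]. *)
  pose tau := \sum_j (x j 0)%:~R *: Z j.
  pose a := tau *m mbasis O 1%g.
  have class0 c : \sum_(m | cyclic_root m == c) a (enum_rank m) 0 = 0.
    apply: (@pms_incl_inj _ _ _ _ sys); rewrite rmorph0 rmorph_sum /=.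
    (* The indicator of one class: the functional [t] built from it reads off one coordinate modulo
       commutators. *)
    pose f m : F := (cyclic_root m == c)%:R.
    have fC u v : f (u * v)%g = f (v * u)%g by rewrite /f cyclic_rootC.
    pose t (E : 'M[F]_#|M|) := \sum_m (E *m mbasis F 1%g) (enum_rank m) 0 * f m.
    have tD A B : t (A + B) = t A + t B.
      by rewrite /t mulmxDl -big_split; apply: eq_bigr => m _; rewrite mxE mulrDl.
    have tC A B : endo A -> endo B -> t (A *m B) = t (B *m A) by apply: class_fun_trace.
    transitivity (t (map_mx (pms_incl sys) tau)).
      rewrite /t -(map_mbasis (pms_incl sys)) -map_mxM -/a big_mkcond.
      apply: eq_bigr => m _ /=.
      by rewrite [in RHS]mxE /f; case: eqP => _; rewrite ?mulr1 ?mulr0.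
    rewrite -[RHS](kernel_weighted_sum (fun i => t (e i)) Dx).
    have tZ (b : F) A : t (b *: A) = b * t A.
      rewrite /t -scalemxAl [RHS]mulr_sumr; apply: eq_bigr => m _.
      by rewrite mxE mulrA.
    have t0 : t 0 = 0 by rewrite -(scale0r 0) tZ mul0r.
    have -> : map_mx (pms_incl sys) tau = \sum_j (x j 0)%:~R *: z j.
      rewrite /tau (raddf_sum (map_mx (pms_incl sys))); apply: eq_bigr => j _ /=.
      by rewrite map_mxZ rmorph_int.
    rewrite (big_morph t tD t0); apply: eq_bigr => j _.
    by rewrite tZ (trace_z t).
  have := sum_class_fun (R := k) (a := fun m => pms_res sys (a (enum_rank m) 0))
    (f := fun m => \tr (lact (T l) m)).
  have -> : \sum_m pms_res sys (a (enum_rank m) 0) * \tr (lact (T l) m) = (x l 0)%:~R.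
    transitivity (\tr (mact (T l) (map_mx (pms_res sys) a))).
      rewrite mxtrace_mact; apply: eq_bigr => m _; by rewrite [in RHS]mxE.
    rewrite map_mxM map_mbasis /tau (raddf_sum (map_mx (pms_res sys))) mulmx_suml.
    (* The character of [T l] is 1 on [e' l] and 0 on the other idempotents, so only [x l]
       survives. *)
    rewrite mact_sum raddf_sum (bigD1 l) //= big1 => [|j ne]; last first.
      have [_ _ resZ] := hZ j; rewrite map_mxZ -scalemxAl mactZ mxtraceZ resZ.
      rewrite (idem_rank_mxtrace (ev_e' j _)).
      by rewrite (rank_ev_top splitk hQ hT he') (negPf ne) mulr0.
    have [_ _ resZ] := hZ l; rewrite map_mxZ -scalemxAl mactZ mxtraceZ resZ.
    rewrite (idem_rank_mxtrace (ev_e' l _)).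
    by rewrite (rank_ev_top splitk hQ hT he') eqxx mulr1 addr0 rmorph_int.
  apply => [u v|c]; first by rewrite !lactM mxtrace_mulC.
  by rewrite -rmorph_sum class0 rmorph0.
have rankD := int_kernel_rank kerD.
split=> // ss; have cDD : cartan Q T = D^T *m D.
  by rewrite cartanE (semisimple_cartan splitF hP hS ss) mulmx1.
rewrite cDD; split=> //; first by rewrite trmx_mul trmxK.
exact: gram_positive_definite.
Qed.
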